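(* For every graph $G$, $\chi_{DP}(G)\le\omega(G)+i(G)$. Moreover, if $G$ is non-chordal and $K_n$-minor-free, then $\chi_{DP}(G)\le n-2+i(G)$.
   Context: All graphs are finite and simple; $\omega$ is the clique number and $\chi_{DP}$ the DP-chromatic (correspondence chromatic) number. A hole of $G$ is an induced cycle of length at least $4$; $G$ is chordal if it has no hole. $\mathcal H(G)$ is the set of holes and $\mathcal H(G,u)$ those containing $u$. A hole cover of $G$ is a nonempty $X\subseteq V(G)$ meeting every hole (any nonempty set if $G$ is chordal). A vertex $u$ satisfies the NC property in $G$ if there are no holes $H\in\mathcal H(G,u)$, $H'\in\mathcal H(G)\setminus\mathcal H(G,u)$ sharing two consecutive edges (two distinct edges with a common end vertex lying on both). A set $\mathcal C$ satisfies the NC property in $G$ if each of its vertices does and every hole contains at most one vertex of $\mathcal C$. Locally chordalizing all holes in $\mathcal H(G,u)$ by $u$ means adding all edges $uw$ with $w\ne u$ lying on some hole in $\mathcal H(G,u)$. For a hole cover $\mathcal C=\{u_1,\dots,u_k\}$ satisfying the NC property in $G$, set $G_0=G$, obtain $G_i$ from $G_{i-1}$ by locally chordalizing all holes in $\mathcal H(G_{i-1},u_i)$ by $u_i$, and put $\widehat G(\mathcal C)=G_k$ (independent of the ordering). Given a hole cover $\mathcal C$ of $G$, an ordered partition $(\mathcal C_1,\dots,\mathcal C_\ell)$ of $\mathcal C$ into nonempty parts is a local chordalization partition if, with $G_0=G_0^*=G-\mathcal C$ and, for $i=1,\dots,\ell$, $G_i$ the graph with $V(G_i)=V(G_{i-1}^*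 )\cup\mathcal C_i$ and $E(G_i)=E(G_{i-1}^* )\cup E\big(G-\bigcup_{j=i+1}^{\ell}\mathcal C_j\big)$ and $G_i^*=\widehat{G_i}(\mathcal C_i)$, each $\mathcal C_i$ is a hole cover of $G_i$ satisfying the NC property in $G_i$ and each $G_i^*$ is chordal. The non-chordality index $i(G)$ is $0$ if $G$ is chordal and otherwise the smallest $\ell$ such that some hole cover of $G$ admits a local chordalization partition with $\ell$ parts. *)

(* Defs.v *)
From Stdlib Require Import ClassicalEpsilon.
From HB Require Import structures.
From mathcomp Require Import all_boot.
Set Implicit Arguments. Unset Strict Implicit. Unset Printing Implicit Defensive.

Section Graphs.
Variable T : finType.

(* A (sub)graph: vertex set [verts] and an edge relation; the actual adjacency
   is the symmetrisation of [edges] restricted to distinct vertices of [verts]. *)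
Record sgraph := SGraph { verts : {set T}; edges : rel T }.

Definition adj (G : sgraph) (x y : T) : bool :=
  [&& x \in verts G, y \in verts G, x != y & edges G x y || edges G y x].

Definition graph_of (e : rel T) : sgraph := SGraph setT e.

(* The induced subgraph G[A] is connected (A nonempty is required separately):
   no nonempty proper subset of A is closed under neighbours inside A. *)
Definition connb (G : sgraph) (A : {set T}) : bool :=
  [forall B : {set T},
     [&& B \subset A, B != set0 &
         [forall x in B, forall y in A, adj G x y ==> (y \in B)]] ==> (B == A)].

(* H is (the vertex set of) a hole: an induced cycle of length >= 4, i.e. the
   induced subgraph G[H] is connected, 2-regular and has >= 4 vertices. *)
Definition hole (G : sgraph) (H : {set T}) : bool :=
  [&& H \subset verts G, 4 <= #|H|,
      [forall x in H, #|[set y in H | adj G x y]| == 2] & connb G H].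

Definition chordal (G : sgraph) : Prop := forall H, ~~ hole G H.

Definition hole_cover (G : sgraph) (X : {set T}) : Prop :=
  [/\ X != set0, X \subset verts G & forall H, hole G H -> H :&: X != set0].

(* H and H' share two consecutive edges a-b, b-c (a <> c). Since holes are
   induced, an edge xy lies on H iff x, y \in H and xy is an edge of G. *)
Definition share2 (G : sgraph) (H H' : {set T}) : Prop :=
  exists a b c, [/\ a \in H :&: H', b \in H :&: H', c \in H :&: H', a != c &
                    adj G a b && adj G b c].

Definition NC_vertex (G : sgraph) (u : T) : Prop :=
  ~ exists H H', [/\ hole G H, u \in H, hole G H', u \notin H' & share2 G H H'].

Definition NC_set (G : sgraph) (C : {set T}) : Prop :=
  (forall u, u \in C -> NC_vertex G u) /\
  (forall H, hole G H -> #|H :&: C| <= 1).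

Definition hole_nbhd (G : sgraph) (u : T) : {set T} :=
  [set w | [exists H : {set T}, [&& hole G H, u \in H & w \in H]]].

Definition lchord (G : sgraph) (u : T) : sgraph :=
  SGraph (verts G) (fun x y => edges G x y || ((x == u) && (y \in hole_nbhd G u))).

(* \hat G(C): chordalize successively by the vertices of C (in the order
   [enum C]; the paper notes the result is independent of the order). *)
Definition hatG (G : sgraph) (C : {set T}) : sgraph := foldl lchord G (enum C).

Definition delv (G : sgraph) (A : {set T}) : sgraph := SGraph (verts G :\: A) (edges G).

Definition ordpart (C : {set T}) (parts : seq {set T}) : Prop :=
  [/\ all (fun D => D != set0) parts,
      pairwise (fun A B : {set T} => [disjoint A & B]) parts &
      \bigcup_(D <- parts) D = C].

(* Conditions of a local chordalization partition, processing the parts in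
   order; [Gprev] is G*_{i-1} (initially G_0* = G - C). *)
Fixpoint lcp_ok (G Gprev : sgraph) (parts : seq {set T}) : Prop :=
  match parts with
  | [::] => True
  | Ci :: rest =>
      let Gi := SGraph (verts Gprev :|: Ci)
                  (fun x y => adj Gprev x y || adj (delv G (\bigcup_(D <- rest) D)) x y) in
      [/\ hole_cover Gi Ci, NC_set Gi Ci, chordal (hatG Gi Ci) &
          lcp_ok G (hatG Gi Ci) rest]
  end.

Definition has_lcp (G : sgraph) (l : nat) : Prop :=
  exists (C : {set T}) (parts : seq {set T}),
    [/\ hole_cover G C, ordpart C parts, size parts = l &
        lcp_ok G (delv G C) parts].

(* nc_index G l  <->  i(G) = l  (if no local chordalization partition exists
   for a non-chordal G, i(G) is undefined/infinite and no l satisfies this). *)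
Definition nc_index (G : sgraph) (l : nat) : Prop :=
  (chordal G /\ l = 0) \/
  (~ chordal G /\ has_lcp G l /\ forall l', has_lcp G l' -> l <= l').

Definition clique (G : sgraph) (S : {set T}) : bool :=
  (S \subset verts G) && [forall x in S, forall y in S, (x != y) ==> adj G x y].

Definition clique_num (G : sgraph) : nat := \max_(S : {set T} | clique G S) #|S|.

Definition has_Kminor (G : sgraph) (n : nat) : Prop :=
  exists B : 'I_n -> {set T},
    (forall i, [/\ B i != set0, B i \subset verts G & connb G (B i)]) /\
    (forall i j, i != j ->
       [disjoint B i & B j] /\ exists x y, [/\ x \in B i, y \in B j & adj G x y]).

(* DP (correspondence) covers with k colours: for each edge uv a matching
   M u v between {u} x [k] and {v} x [k]; no matching on non-edges. *)
Definition dp_cover (G : sgraph) (k : nat) (M : T -> T -> 'I_k -> 'I_k -> bool) : Prop :=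
  [/\ forall u v i j, M u v i j -> adj G u v,
      forall u v i j, M u v i j = M v u j i,
      forall u v i j j', M u v i j -> M u v i j' -> j = j' &
      forall u v i i' j, M u v i j -> M u v i' j -> i = i'].

Definition DP_colorable (e : rel T) (k : nat) : Prop :=
  forall M, dp_cover (graph_of e) M ->
    exists f : T -> 'I_k, forall u v, ~~ M u v (f u) (f v).

Definition DP_colorableb (e : rel T) (k : nat) : bool :=
  if excluded_middle_informative (DP_colorable e k) then true else false.

Lemma DP_colorable_card (e : rel T) : DP_colorable e #|T|.
Proof.
move=> M [Madj Msym Mf Mi].
suff: forall n (S : {set T}), #|S| <= n ->
  exists f : T -> 'I_#|T|, forall u v, u \in S -> v \in S -> ~~ M u v (f u) (f v).
  move=> /(_ #|T| setT (max_card _)) [f Hf]; exists f => u v; exact: Hf.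
elim=> [|n IH] S.
  rewrite leqn0 cards_eq0 => /eqP ->.
  by exists (fun x => enum_rank x) => u v; rewrite in_set0.
case: (set_0Vmem S) => [-> _|[x xS] cS].
  by exists (fun x => enum_rank x) => u v; rewrite in_set0.
have cS' : #|S :\ x| <= n by rewrite -ltnS (cardsD1 x S) xS add1n in cS.
have [f' Hf'] := IH _ cS'.
pose g u := odflt (enum_rank x) [pick j | M x u j (f' u)].
pose F := [set j | [exists u in S :\ x, M x u j (f' u)]].
have FS : F \subset g @: (S :\ x).
  apply/subsetP => j; rewrite inE => /existsP [u /andP [uS Mj]].
  apply/imsetP; exists u => //; rewrite /g.
  case: pickP => [j' Mj'|/(_ j)]; last by rewrite Mj.
  by rewrite /= (Mi _ _ _ _ _ Mj Mj').
have cF : #|F| < #|'I_#|T| |.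
  rewrite card_ord; apply: (leq_ltn_trans (subset_leq_card FS)).
  apply: (leq_ltn_trans (leq_imset_card _ _)).
  apply: (leq_trans _ (max_card S)).
  by rewrite [X in _ <= X](cardsD1 x S) xS.
have [c cF'] : exists c, c \notin F.
  apply/existsP; rewrite -negb_forall; apply/negP => /forallP allF.
  have : #|'I_#|T| | <= #|F| by apply: subset_leq_card; apply/subsetP => j _; exact: allF.
  by rewrite leqNgt cF.
exists (fun y => if y == x then c else f' y) => u v uS vS.
have Mxx : forall i j, ~~ M x x i j.
  by move=> i j; apply/negP => /Madj; rewrite /adj eqxx !andbF.
have Hx : forall w, w \in S -> w != x -> ~~ M x w c (f' w).
  move=> w wS wx; apply/negP => Mw; move: cF'; rewrite inE => /existsP; apply.
  by exists w; rewrite !inE wx wS Mw.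
case: (eqVneq u x) => [->|ux]; case: (eqVneq v x) => [->|vx] //.
- exact: Hx.
- by rewrite Msym; apply: Hx.
- by apply: Hf'; rewrite !inE ?ux ?vx.
Qed.

Lemma DP_colorable_exists (e : rel T) : exists k, DP_colorableb e k.
Proof.
exists #|T|; rewrite /DP_colorableb.
by case: excluded_middle_informative => // -[]; apply: DP_colorable_card.
Qed.

Definition chi_DP (e : rel T) : nat := ex_minn (DP_colorable_exists e).

End Graphs.

(* Main.v *)
Require Import Defs.
From Stdlib Require Import ClassicalEpsilon.
From HB Require Import structures.
From mathcomp Require Import all_boot.
Set Implicit Arguments. Unset Strict Implicit. Unset Printing Implicit Defensive.

(* A local chordalization partition turns G into a chordal supergraph F, and
   chordal graphs are greedily DP-colourable with as many colours as their
   clique number, so it suffices to bound the cliques of F.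

   If C satisfies the NC property, chordalizing by u in C destroys the holes
   through u and creates none, so every edge added by C joins some u in C to a
   vertex on a common hole of the graph before the step. The NC property forces
   all the edges added inside one clique K to share the same u, hence K minus u
   was already a clique: each part costs at most one vertex, which gives
   omega(G) + i(G).

   At the first part the graph is an induced subgraph of G, and u needs not be
   deleted: for each vertex w of K that was not adjacent to u, one of the two
   arcs of a hole through u and w avoids the clique K - u, so contracting these
   arcs into u exhibits a clique minor of G of order |K|. This saves one. *)

Section Graphs.
Variable T : finType.
Implicit Types (G F : sgraph T) (S H K A B C I P Q R X V L N D : {set T}) (p q : seq T).

(** * Induced paths and holes *)

Lemma adjC G x y : adj G x y = adj G y x.
Proof. by rewrite /adj andbCA eq_sym orbC. Qed.

Lemma adj_neq G x y : adj G x y -> x != y.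
Proof. by case/and4P. Qed.

Lemma adj_verts G x y : adj G x y -> (x \in verts G) && (y \in verts G).
Proof. by case/and4P=> -> ->. Qed.

Lemma adjxx G x : adj G x x = false.
Proof. by rewrite /adj eqxx !andbF. Qed.

Definition ladj G S : rel T := fun x y => [&& x \in S, y \in S & adj G x y].
(** As [connect] is reflexive, [conn G S x x] holds even for [x] outside [S]; between distinct ends
    the whole walk lies in [S]. *)
Definition conn G S : rel T := connect (ladj G S).
Definition connected G S := {in S &, forall x y, conn G S x y}.

Lemma conn_sym G S x y : conn G S x y = conn G S y x.
Proof.
apply: sym_connect_sym => a b; rewrite /ladj adjC.
by case: (a \in S); case: (b \in S).
Qed.

Lemma conn_trans G S y x z : conn G S x y -> conn G S y z -> conn G S x z.
Proof. exact: connect_trans. Qed.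

Lemma conn_sub G S S' x y : S \subset S' -> conn G S x y -> conn G S' x y.
Proof.
move=> /subsetP sS; apply: connect_sub => a b /and3P [aS bS ab].
by apply: connect1; rewrite /ladj !sS.
Qed.

Lemma conn_adj G S x y : x \in S -> y \in S -> adj G x y -> conn G S x y.
Proof. by move=> xS yS xy; apply: connect1; rewrite /ladj xS yS. Qed.

Lemma conn_closed G S B x y :
  (forall a b, a \in B -> b \in S -> adj G a b -> b \in B) ->
  conn G S x y -> x \in B -> y \in B.
Proof.
move=> cB /connectP [p]; elim: p x => [x _ -> //|z p IH x /= /andP [/and3P [_ zS xz] pz] lp xB].
by apply: (IH z) => //; apply: cB xz.
Qed.

Lemma path_conn G S x p :
  path (adj G) x p -> {subset x :: p <= S} -> {in x :: p &, forall y z, conn G S y z}.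
Proof.
move=> xp pS.
have H : forall z, z \in x :: p -> conn G S x z.
  elim: p x xp pS => [x _ _ z|y p IH x /= /andP [xy yp] pS z].
    by rewrite inE => /eqP ->; apply: connect0.
  rewrite inE => /predU1P [->|zp]; first exact: connect0.
  apply: (@conn_trans _ _ y); last first.
    by apply: IH => // t tp; apply: pS; rewrite inE tp orbT.
  by apply: conn_adj => //; apply: pS; rewrite !inE eqxx ?orbT.
by move=> y z yp zp; apply: (conn_trans (y := x)); rewrite ?H // conn_sym H.
Qed.

Lemma connected_seq G x p : path (adj G) x p -> connected G [set z in x :: p].
Proof.
move=> xp y z; rewrite !in_set => yp zp.
by apply: path_conn yp zp => // t; rewrite in_set.
Qed.

Lemma connected_connb G A : connected G A -> connb G A.
Proof.
move=> cA; apply/forallP => B; apply/implyP => /and3P [sB /set0Pn [x xB] /forall_inP cB].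
rewrite eqEsubset sB; apply/subsetP => y yA.
have xA := subsetP sB _ xB.
apply: (conn_closed _ (cA _ _ xA yA) xB) => a b aB bA ab.
by move/forall_inP: (cB a aB) => /(_ b bA)/implyP; apply.
Qed.

Lemma connected1 G x : connected G [set x].
Proof. by move=> y z; rewrite !inE => /eqP -> /eqP ->; apply: connect0. Qed.

Lemma connectedU G A B a b : connected G A -> connected G B -> a \in A -> b \in B ->
  (a == b) || adj G a b -> connected G (A :|: B).
Proof.
move=> cA cB aA bB ab.
have sA : A \subset A :|: B := subsetUl _ _.
have sB : B \subset A :|: B := subsetUr _ _.
have cab : conn G (A :|: B) a b.
  case/predU1P: ab => [->|ab]; first exact: connect0.
  by apply: conn_adj; rewrite // inE ?aA ?bB ?orbT.
have H : forall z, z \in A :|: B -> conn G (A :|: B) a z.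
  move=> z; rewrite inE => /orP [zA|zB]; first by apply: conn_sub sA _; apply: cA.
  by apply: conn_trans cab _; apply: conn_sub sB _; apply: cB.
by move=> y z yS zS; apply: (conn_trans (y := a)); rewrite ?H // conn_sym H.
Qed.

Lemma path_ladj G S x p : x \in S -> path (ladj G S) x p -> {subset x :: p <= S}.
Proof.
elim: p x => [x xS _ z|a p IH x xS /= /andP [/and3P [_ aS _] pa] z].
  by rewrite inE => /eqP ->.
by rewrite inE => /predU1P [->//|]; apply: IH.
Qed.

Lemma shortest_path G S x y : conn G S x y ->
  exists p, [/\ path (ladj G S) x p, last x p = y, uniq (x :: p) &
    forall q, path (ladj G S) x q -> last x q = y -> size p <= size q].
Proof.
case/connectP=> p0 xp0 lp0.
(* Tuples of a fixed length form a finite type, so the existence of a path of length [n] is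
   decidable and [ex_minnP] applies. *)
pose Pn n := [exists p : n.-tuple T, path (ladj G S) x p && (last x p == y)].
have exP : exists n, Pn n.
  by exists (size p0); apply/existsP; exists (in_tuple p0); rewrite /= xp0 -lp0 eqxx.
case: (ex_minnP exP) => n /existsP [p /andP [xp /eqP lp]] minn.
case/shortenP: xp lp => q xq uq sq lq.
have szq : size q <= n.
  rewrite -(size_tuple p); apply: uniq_leq_size sq.
  by case/andP: uq.
exists q; split=> // r xr lr; apply: leq_trans szq _; apply: minn.
by apply/existsP; exists (in_tuple r); rewrite /= xr lr eqxx.
Qed.

(** A chord would let the path jump from position [i] to position [j] and become shorter. *)
Lemma shortest_path_chordless G S x y p i j :
  path (ladj G S) x p -> last x p = y ->
  (forall q, path (ladj G S) x q -> last x q = y -> size p <= size q) ->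
  {subset x :: p <= S} ->
  i < j -> j <= size p -> adj G (nth x (x :: p) i) (nth x (x :: p) j) -> j = i.+1.
Proof.
move=> xp lp minp pS ij; case: j ij => // j ij jp aij.
have {}ij : i <= j := ij.
(* Here [j] is the old index minus one: [x :: take i p] ends at the near end of the chord and
   [drop j p] starts at its far end. *)
pose q := take i p ++ drop j p.
have ip : i <= size p := leq_trans ij (ltnW jp).
have lt : last x (take i p) = nth x (x :: p) i.
  by rewrite (last_nth x) size_takel //; case: (i) ip => //= k kp; rewrite nth_take.
have dj : drop j p = nth x p j :: drop j.+1 p := drop_nth x jp.
have xq : path (ladj G S) x q.
  rewrite cat_path take_path //= lt dj /=.
  rewrite -(cat_take_drop j p) cat_path dj /= in xp.
  case/and3P: xp => _ _ ->; rewrite andbT /ladj aij andbT !pS //.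
  - by rewrite inE mem_nth ?orbT.
  - by apply: mem_nth.
have lq : last x q = y.
  by rewrite -lp -[in RHS](cat_take_drop j p) !last_cat dj.
have := minp q xq lq; rewrite size_cat size_takel // size_drop => le.
apply/eqP; rewrite eqSS eqn_leq ij andbT -(leq_add2r (size p - j)).
by rewrite subnKC // ltnW.
Qed.

(* A shortest x-y path inside S closes up to a hole through its apex u. *)
Lemma apex_hole G S u x y :
  u \notin S -> x \in S -> y \in S -> adj G u x -> adj G u y -> x != y -> ~~ adj G x y ->
  (forall z, z \in S -> adj G u z -> z = x \/ z = y) -> conn G S x y ->
  exists H, [/\ hole G H, H \subset u |: S, [/\ u \in H, x \in H & y \in H] &
                conn G (H :\ u) x y].
Proof.
move=> uS xS yS ux uy xy nxy nbu /shortest_path [p [xp lp up minp]].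
have pS := path_ladj xS xp.
have ch := shortest_path_chordless xp lp minp pS.
have xpa : path (adj G) x p by apply: sub_path xp => a b /and3P [].
have szp : 1 < size p.
  case: p lp xy xpa nxy {xp up minp pS ch} => [/= -> /eqP //|a [|//]] /= -> _.
  by rewrite andbT => ->.
have u_p : u \notin x :: p by apply: contra uS => /pS.
pose s := x :: p.
have ns : forall i, i <= size p -> nth x s i \in s by move=> i ip; apply: mem_nth.
have nadj i : i < size p -> adj G (nth x s i) (nth x s i.+1).
  by move=> ip; apply: (pathP x xpa).
have n0 : nth x s 0 = x by [].
have nl : nth x s (size p) = y by rewrite -lp (last_nth x).
have nuq i j : i <= size p -> j <= size p -> (nth x s i == nth x s j) = (i == j).
  by move=> ip jp; rewrite nth_uniq.
pose H := u |: [set z in s].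
have inH z : (z \in H) = (z == u) || (z \in s) by rewrite !inE.
exists H; split.
- have card2 z : z \in H -> #|[set w in H | adj G z w]| == 2.
    rewrite inH => /predU1P [->|zs].
      rewrite (_ : [set w in H | adj G u w] = [set x; y]) ?cards2 ?xy //.
      apply/setP=> w; rewrite in_set inH in_set2; apply/andP/idP.
        case=> /predU1P [->|ws] uw; first by rewrite adjxx in uw.
        by case: (nbu w (pS _ ws) uw) => ->; rewrite eqxx ?orbT.
      case/orP=> /eqP ->; split=> //; first by rewrite mem_head orbT.
      by rewrite -nl ns ?orbT.
    case/(nthP x): zs => i; rewrite ltnS => ip <-{z}.
    (* The two neighbours of the [i]-th path vertex on the closed cycle, with [u] taking over at
       both ends of the path. *)
    pose a := if i == 0 then u else nth x s i.-1.
    pose b := if i == size p then u else nth x s i.+1.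
    have ab : a != b.
      rewrite /a /b; case: (eqVneq i 0) ip => [-> _|i0 ip].
        case: (eqVneq 0 (size p)) => [e0|_]; first by rewrite -e0 in szp.
        by apply: contraNneq u_p => ->; apply: ns; apply: ltnW.
      case: (eqVneq i (size p)) => [_|il].
        by apply: contraNneq u_p => <-; apply: ns; apply: leq_trans (leq_pred _) ip.
      have il' : i < size p by rewrite ltn_neqAle il.
      rewrite nuq //; last exact: leq_trans (leq_pred _) ip.
      by rewrite neq_ltn ltnS leq_pred.
    rewrite (_ : [set w in H | _] = [set a; b]) ?cards2 ?ab //.
    apply/setP=> w; rewrite in_set inH in_set2; apply/andP/idP.
      case=> /predU1P [->|ws] iw.
        rewrite adjC in iw.
        have := nbu _ (pS _ (ns _ ip)) iw => -[]/eqP.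
          by rewrite -[X in _ == X]n0 nuq // /a => ->; rewrite eqxx.
        by rewrite -nl nuq // /b => ->; rewrite eqxx orbT.
      case/(nthP x): ws iw => j; rewrite ltnS => jp <- iw.
      case: (ltngtP i j) iw => [ij|ji|->]; last by rewrite adjxx.
        move/(ch _ _ ij jp) => ej; subst j.
        by rewrite /b ltn_eqF // eqxx orbT.
      rewrite adjC => /(ch _ _ ji ip) ei; subst i.
      by rewrite /a /= eqxx.
    case/orP=> /eqP ->; rewrite /a /b; split.
    - by case: ifP => _; rewrite ?eqxx // ns ?orbT // (leq_trans (leq_pred _) ip).
    - case: eqP => [->|/eqP]; first by rewrite n0 adjC.
      by rewrite -lt0n => i0; rewrite -[in X in adj G X](prednK i0) adjC nadj // prednK.
    - case: (eqVneq i (size p)) => [_|il]; first by rewrite eqxx.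
      by apply/orP; right; apply: ns; rewrite ltn_neqAle il.
    - case: eqP => [->|/eqP il]; first by rewrite nl adjC.
      by rewrite nadj // ltn_neqAle il.
  apply/and4P; split.
  + apply/subsetP => z; rewrite inH => /predU1P [->|zs].
      by case/andP: (adj_verts ux).
    case/(nthP x): zs => i; rewrite ltnS => ip <-.
    case: (ltngtP i (size p)) ip => // [il _|-> _].
      by case/andP: (adj_verts (nadj _ il)).
    by rewrite nl; case/andP: (adj_verts uy).
  + rewrite cardsU1 inE u_p cardsE (card_uniqP up) /=.
    by rewrite add1n !ltnS.
  + by apply/forallP=> z; apply/implyP => /card2.
  + apply: connected_connb.
    rewrite (_ : H = [set z in u :: x :: p]); last by apply/setP=> z; rewrite !inE.
    by apply: connected_seq; rewrite /= ux.
- by apply/subsetP=> z; rewrite inH => /predU1P [->|/pS zS]; rewrite !inE ?eqxx ?zS ?orbT.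
- by rewrite !inH eqxx mem_head -nl ns ?orbT.
- apply: (path_conn xpa); rewrite -?nl ?ns ?mem_head //.
  move=> z zs; rewrite in_setD1 inH zs orbT andbT.
  by apply: contraNneq u_p => <-.
Qed.

Lemma hole_deg G H x a b c : hole G H -> x \in H -> a \in H -> b \in H -> c \in H ->
  adj G x a -> adj G x b -> adj G x c -> a != b -> c = a \/ c = b.
Proof.
case/and4P=> _ _ /forall_inP d _ xH aH bH cH xa xb xc ab.
case: (eqVneq c a) => [|ca]; first by left.
case: (eqVneq c b) => [|cb]; first by right.
have : #|[set c; a; b]| <= 2.
  rewrite -(eqP (d x xH)); apply: subset_leq_card; apply/subsetP => z.
  by rewrite !inE => /orP [/orP [] /eqP ->|/eqP ->]; apply/andP.
by rewrite -setUA cardsU1 cards2 !inE negb_or ca cb ab.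
Qed.

Lemma hole_nbr G H x a : hole G H -> x \in H -> exists b, [/\ b != a, b \in H & adj G x b].
Proof.
case/and4P=> _ _ /forall_inP d _ xH.
have /set0Pn [b] : [set y in H | adj G x y] :\ a != set0.
  rewrite -card_gt0 -(ltn_add2l (a \in [set y in H | adj G x y])) -cardsD1 (eqP (d x xH)).
  by case: (a \in _).
by rewrite !inE => /and3P [ba bH xb]; exists b.
Qed.

(** A hole is given as a connected 2-regular set, so a cyclic listing has to be built. A path from
    [u] grows inside [H] until a vertex repeats; regularity forces that vertex to be [u], and the
    listed set, being closed under neighbours in [H], is [H] by connectivity. *)
Lemma hole_cycle G H u : hole G H -> u \in H ->
  exists p, [/\ uniq (u :: p), path (adj G) u p, adj G (last u p) u, 2 < size p &
                H = [set x in u :: p]].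
Proof.
move=> hH uH.
(* [n] bounds the extensions still possible: at [n = 0] the list [u :: p] would outnumber [H]. *)
have ext : forall n p, #|H| <= n + size p -> path (adj G) u p -> uniq (u :: p) ->
    {subset u :: p <= H} -> exists p', [/\ uniq (u :: p'), path (adj G) u p',
      adj G (last u p') u, 1 < size p' & {subset u :: p' <= H}].
  elim=> [|n IH] p szp up unp sub.
    have : #|u :: p| <= #|H| by apply: subset_leq_card; apply/subsetP.
    by rewrite (card_uniqP unp) /= => /leq_trans /(_ szp); rewrite ltnn.
  case/lastP: p szp up unp sub => [|p z] szp up unp sub.
    have [b [bu bH ub]] := hole_nbr u hH uH.
    apply: (IH [:: b]); rewrite /= ?ub ?addn1 //; first by rewrite addn0 in szp.
      by rewrite inE eq_sym bu.
    by move=> t; rewrite !inE => /orP [] /eqP ->.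
  have zH : z \in H by apply: sub; rewrite inE mem_rcons mem_head orbT.
  have [t [tl tH zt]] := hole_nbr (last u p) hH zH.
  case: (boolP (t \in u :: rcons p z)) => tin; last first.
    apply: (IH (rcons (rcons p z) t)).
    - by rewrite size_rcons addnS -addSn.
    - by rewrite rcons_path up last_rcons.
    - by rewrite -rcons_cons rcons_uniq tin.
    - by move=> s; rewrite -rcons_cons mem_rcons inE => /predU1P [->|/sub].
  case: (eqVneq t u) => [tu|tu].
    exists (rcons p z); split=> //; first by rewrite last_rcons -tu.
    by rewrite size_rcons; case: (p) tl tu => //= /eqP.
  have tz : t != z by rewrite eq_sym (adj_neq zt).
  have tp : t \in p.
    by move: tin; rewrite inE mem_rcons inE (negbTE tu) (negbTE tz).
  (* A return to an inner vertex [t] gives it three neighbours in [H]: its predecessor, its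
     successor [s] and [z]. If nothing follows [t] in [p], it is [last u p], which [tl] excludes. *)
  case/splitPr: tp tl up unp sub {IH szp tin} => p1 [|s p2].
    by rewrite last_cat eqxx.
  move=> tl up unp sub.
  have : adj G t (last u p1) && adj G t s.
    move: up; rewrite rcons_path cat_path /= => /andP [/and3P [_ l1 /andP [ts _]] _].
    by rewrite adjC l1.
  case/andP=> tl1 ts; rewrite adjC in zt.
  have l1H : last u p1 \in H.
    by apply: sub; rewrite -rcons_cons -cat_cons mem_rcons inE mem_cat mem_last orbT.
  have sH : s \in H.
    by apply: sub; rewrite !(inE, mem_rcons, mem_cat) eqxx !orbT.
  move: unp; rewrite -rcons_cons -cat_cons rcons_uniq cat_uniq.
  case/and3P=> zn _ /andP [/hasPn dis _].
  have s_in : s \in [:: t, s & p2] by rewrite !inE eqxx orbT.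
  have zs' : z != s.
    by apply: contraNneq zn => ->; rewrite mem_cat s_in orbT.
  have l1s : last u p1 != s.
    by apply: contraNneq (dis _ s_in) => <-; apply: mem_last.
  have zl1 : z != last u p1.
    by apply: contraNneq zn => ->; rewrite mem_cat mem_last.
  case: (hole_deg hH tH l1H sH zH tl1 ts zt l1s) => e.
    by rewrite e eqxx in zl1.
  by rewrite e eqxx in zs'.
have [||||p [unp up lp szp sub]] := ext #|H| [::]; rewrite ?addn0 //.
  by move=> t; rewrite inE => /eqP ->.
have eH : [set x in u :: p] = H.
  case/and4P: (hH) => _ _ _ /forallP /(_ [set x in u :: p]) /implyP cH.
  apply/eqP/cH/and3P; split.
  - by apply/subsetP => t; rewrite inE => /sub.
  - by apply/set0Pn; exists u; rewrite inE mem_head.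
  - apply/forall_inP => x; rewrite inE => xp; apply/forall_inP => y yH.
    apply/implyP => xy.
    (* Rotating the cycle to start at [x] puts its two neighbours second and last. *)
    have [i q eq_q] := rot_to xp.
    have cyc : cycle (adj G) (x :: q) by rewrite -eq_q rot_cycle /= rcons_path up.
    have unq : uniq (x :: q) by rewrite -eq_q rot_uniq.
    have szq : size q = size p.
      by have := congr1 size eq_q; rewrite size_rot /= => -[].
    have mq : x :: q =i u :: p by move=> t; rewrite -eq_q mem_rot.
    rewrite inE -mq.
    case: q szq cyc unq mq {eq_q} => [/esym e|b q szq cyc unq mq]; first by rewrite e in szp.
    case/lastP: q szq cyc unq mq => [e|q c szq cyc unq mq]; first by rewrite -e in szp.
    have xH : x \in H by apply: sub.
    have bH : b \in H by apply: sub; rewrite -mq !inE eqxx orbT.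
    have cH' : c \in H by apply: sub; rewrite -mq !(inE, mem_rcons) eqxx !orbT.
    move: cyc; rewrite /= rcons_path last_rcons => /and3P [xb _ cx].
    rewrite adjC in cx.
    have bc : b != c.
      by move: unq => /= /and3P [_ nb _]; apply: contraNneq nb => ->; rewrite mem_rcons mem_head.
    case: (hole_deg hH xH bH cH' yH xb cx xy bc) => ->;
      by rewrite !(inE, mem_rcons) eqxx ?orbT.
exists p; split=> //.
case/and4P: hH => _ c4 _ _; move: c4; rewrite -eH cardsE (card_uniqP unp) /=.
by rewrite ltnS.
Qed.

Definition one_nbr G u P := exists x, [/\ x \in P, adj G u x &
  forall z, z \in P -> adj G u z -> z = x].

(** Models the two paths left of a hole when two nonadjacent vertices are deleted; as connected sets
    rather than sequences, they combine easily with other connected sets. *)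
Definition arcs G H u a P Q :=
  [/\ [/\ P \subset H, Q \subset H & [disjoint P & Q]],
      [/\ u \notin P, u \notin Q, a \notin P & a \notin Q],
      connected G P /\ connected G Q,
      [/\ one_nbr G u P, one_nbr G u Q, one_nbr G a P & one_nbr G a Q] &
      forall x y, x \in P -> y \in Q -> ~~ adj G x y].

Lemma arcsC G H u a P Q : arcs G H u a P Q -> arcs G H u a Q P.
Proof.
case=> [[h1 h2 h3] [h4 h5 h6 h7] [h8 h9] [h10 h11 h12 h13] h14].
split=> //; first by split=> //; rewrite disjoint_sym.
by move=> x y xQ yP; rewrite adjC h14.
Qed.

(** The cyclic listing from [u] is cut at [a]. Nonadjacency makes both pieces nonempty, and
    2-regularity leaves no room for an edge between them. *)
Lemma hole_arcs G H u a : hole G H -> u \in H -> a \in H -> a != u -> ~~ adj G u a ->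
  exists P Q, arcs G H u a P Q.
Proof.
move=> hH uH aH au nua.
have [p [unp up lp _ eH]] := hole_cycle hH uH.
have ap : a \in p by move: aH; rewrite eH !inE (negbTE au).
case/splitPr: ap unp up lp eH => p1 p2 unp up lp eH.
case: p1 unp up lp eH => [|x p1] unp up lp eH.
  by move: up; rewrite /= (negbTE nua).
case: p2 unp up lp eH => [|y p2] unp up lp eH.
  by move: lp; rewrite last_cat /= adjC (negbTE nua).
set P1 := x :: p1 in unp up lp eH *; set P2 := y :: p2 in unp up lp eH *.
have inH z : (z \in H) = [|| z == u, z \in P1, z == a | z \in P2].
  by rewrite eH !(inE, mem_cat).
have [u1 [ua u2]] : u \notin P1 /\ u != a /\ u \notin P2.
  by case/andP: unp; rewrite mem_cat negb_or inE negb_or => /and3P [].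
move: (unp); rewrite cons_uniq cat_uniq => /and4P [_ uq1 /hasPn d12 /andP [a2 _]].
have a1 : a \notin P1 by apply: d12; rewrite mem_head.
have d12' z : z \in P1 -> z \notin P2.
  by move=> z1; apply: contraTN z1 => z2; apply: d12; rewrite inE z2 orbT.
move: up; rewrite cat_path -/P1 /= => /and3P [/andP [ux xp1] l1a /andP [ay yp2]].
rewrite last_cat /= in lp.
have xH : x \in H by rewrite inH mem_head orbT.
have yH : y \in H by rewrite inH mem_head !orbT.
have l1H : last x p1 \in H by rewrite inH mem_last orbT.
have l2H : last y p2 \in H by rewrite inH mem_last !orbT.
have xl2 : x != last y p2.
  by apply: contraTneq (mem_last y p2) => <-; apply: d12'; rewrite mem_head.
have l1y : last x p1 != y.
  by apply: contraTneq (mem_last x p1) => ->; apply: contraL (mem_head y p2) => /d12'.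
rewrite adjC in lp; rewrite adjC in l1a.
have nbu z : z \in H -> adj G u z -> z = x \/ z = last y p2.
  by move=> zH uz; apply: (hole_deg hH uH).
have nba z : z \in H -> adj G a z -> z = last x p1 \/ z = y.
  by move=> zH uz; apply: (hole_deg hH aH).
have s1 z : z \in P1 -> z \in H by rewrite inH => ->; rewrite orbT.
have s2 z : z \in P2 -> z \in H by rewrite inH => ->; rewrite !orbT.
exists [set z in P1], [set z in P2]; split.
- split; try by apply/subsetP=> z; rewrite inE => zP; auto.
  by rewrite disjoint_subset; apply/subsetP => z; rewrite !inE => /d12'.
- by split; rewrite inE.
- by split; apply: connected_seq.
- split.
  + exists x; split=> [|//|z]; first by rewrite inE mem_head.
    rewrite inE => z1 /(nbu _ (s1 _ z1)) [//|e].
    by have := d12' _ z1; rewrite e mem_last.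
  + exists (last y p2); split=> [|//|z]; first by rewrite inE mem_last.
    rewrite inE => z2 /(nbu _ (s2 _ z2)) [e|//].
    by have := d12' x (mem_head _ _); rewrite -e z2.
  + exists (last x p1); split=> [|//|z]; first by rewrite inE mem_last.
    rewrite inE => z1 /(nba _ (s1 _ z1)) [//|e].
    by have := d12' _ z1; rewrite e mem_head.
  + exists y; split=> [|//|z]; first by rewrite inE mem_head.
    rewrite inE => z2 /(nba _ (s2 _ z2)) [e|//].
    by have := d12' _ (mem_last x p1); rewrite -e z2.
move=> z w; rewrite !in_set => z1 w2; apply/negP => zw.
have [q1 [q2 e1]] : exists q1 q2, P1 = q1 ++ z :: q2.
  by case/splitPr: (P1) / z1 => q1 q2; exists q1, q2.
have zH := s1 _ z1; have wH := s2 _ w2.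
have pz : path (adj G) u (rcons (q1 ++ z :: q2) a).
  by rewrite -e1 rcons_path /= ux xp1 adjC.
move: pz; rewrite rcons_cat cat_path /= => /and3P [_ lz].
have hb : {subset q1 <= P1} by move=> t t1; rewrite e1 mem_cat t1.
have hc : {subset q2 <= P1} by move=> t t1; rewrite e1 mem_cat inE t1 !orbT.
have lin : last u q1 \in u :: q1 := mem_last _ _.
have lin' : (last u q1 == u) || (last u q1 \in P1).
  by move: lin; rewrite inE => /orP [->//|/hb ->]; rewrite orbT.
(* [b] follows [z] on the cycle: the next vertex of the arc, or [a] if [z] is the last. Together
   with the vertex before [z] it uses up the degree of [z]. *)
have [b [zb bin bl]] : exists b, [/\ path (adj G) z (rcons q2 a) -> adj G z b,
     (b == a) || (b \in P1) & b != last u q1].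
  have uq' : uniq (u :: q1 ++ z :: q2) by rewrite -e1 cons_uniq u1.
  case: q2 e1 hc uq' => [|b q2] e1 hc uq'.
    exists a; split; rewrite ?eqxx //=; first by rewrite andbT.
    apply: contraTneq lin' => <-; rewrite negb_or a1 eq_sym ua //.
  exists b; split; rewrite /= ?hc ?mem_head ?orbT //; first by case/andP.
  move: uq'; rewrite -cat_cons cat_uniq => /and3P [_ /hasPn h _].
  have /h : b \in z :: b :: q2 by rewrite !inE eqxx orbT.
  by apply: contraNneq => ->; apply: mem_last.
move=> /zb {}zb; rewrite adjC in lz.
have lH : last u q1 \in H by rewrite inH orbA lin'.
have bH : b \in H by rewrite inH; case/orP: bin => ->; rewrite !orbT.
rewrite eq_sym in bl.
case: (hole_deg hH zH lH bH wH lz zb zw bl) => ew.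
  by move: lin'; rewrite -ew => /predU1P [e|/d12']; [rewrite -e w2 in u2|rewrite w2].
by move: bin; rewrite -ew => /predU1P [e|/d12']; [rewrite -e w2 in a2|rewrite w2].
Qed.

(** * The NC property *)

Definition touch G A B := [exists a in A, exists b in B, (a == b) || adj G a b].

Lemma touchP G A B :
  reflect (exists a b, [/\ a \in A, b \in B & (a == b) || adj G a b]) (touch G A B).
Proof.
apply: (iffP exists_inP) => [[a aA /exists_inP [b bB ab]]|[a [b [aA bB ab]]]].
  by exists a, b.
by exists a => //; apply/exists_inP; exists b.
Qed.

Lemma touchC G A B : touch G A B = touch G B A.
Proof.
apply/touchP/touchP => -[a [b [aA bB ab]]]; exists b, a;
  by rewrite eq_sym adjC.
Qed.

Lemma connectedU_touch G A B :
  connected G A -> connected G B -> touch G A B -> connected G (A :|: B).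
Proof. by move=> cA cB /touchP [a [b [aA bB ab]]]; apply: connectedU ab. Qed.

Lemma hole_nbhdP G u w :
  reflect (exists H, [/\ hole G H, u \in H & w \in H]) (w \in hole_nbhd G u).
Proof.
rewrite inE; apply: (iffP existsP) => -[H]; first by case/and3P; exists H.
by case=> *; exists H; apply/and3P.
Qed.

(* If X joined the two arcs, apex a would lie on a hole that avoids u and
   shares with H the two edges at a. *)
Lemma nc_touch G u H a P Q X : NC_vertex G u -> hole G H -> u \in H -> a \in H ->
  a != u -> arcs G H u a P Q -> connected G X -> u \notin X -> a \notin X ->
  (forall z, z \in X -> ~~ adj G a z) -> touch G P X -> touch G Q X -> False.
Proof.
move=> nc hH uH aH au [[sP sQ dPQ] [uP uQ aP aQ] [cP cQ] [_ _ [x [xP ax Px]] [y [yQ ay Qy]]] PQ]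
  cX uX aX naX tP tQ.
pose S := P :|: X :|: Q.
have cS : connected G S.
  apply: connectedU_touch => //; first exact: connectedU_touch.
  move: tQ; rewrite touchC => /touchP [t [q [tX qQ tq]]].
  by apply/touchP; exists t, q; rewrite inE tX orbT.
have xS : x \in S by rewrite !inE xP.
have yS : y \in S by rewrite !inE yQ !orbT.
have xy : x != y by apply: contraTneq yQ => <-; rewrite (disjointFr dPQ xP).
have [||H' [hH' sH' [aH' xH' yH'] _]] :=
    apex_hole _ xS yS ax ay xy (PQ _ _ xP yQ) _ (cS _ _ xS yS).
- by rewrite !inE !negb_or aP aX.
- move=> z; rewrite !inE => /orP [/orP [zP|zX]|zQ] az; [left|exfalso|right]; auto.
  by move: (naX z zX); rewrite az.
apply: nc; exists H, H'; split=> //.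
  apply/negP => /(subsetP sH'); rewrite !inE eq_sym (negbTE au) (negbTE uP).
  by rewrite (negbTE uQ) (negbTE uX).
exists x, a, y; rewrite !inE (subsetP sP _ xP) (subsetP sQ _ yQ) aH aH' xH' yH' xy.
by rewrite adjC ax ay.
Qed.

(** A connection from [u] to [a]: either [a] alone, when adjacent to [u], or [a] with one arc of a
    hole through both. Having one neighbour of [u] suits it to [apex_hole]. *)
Definition leg G u a A := [/\ a \in A, u \notin A, connected G A & one_nbr G u A].

Lemma leg1 G u a : adj G u a -> leg G u a [set a].
Proof.
move=> ua; split; rewrite ?inE ?(adj_neq ua) //; first exact: connected1.
by exists a; split; rewrite ?inE // => z; rewrite inE => /eqP.
Qed.

Lemma arc_leg G H u a P Q : a != u -> ~~ adj G u a -> arcs G H u a P Q ->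
  leg G u a (a |: P).
Proof.
move=> au nua [_ [uP _ _ _] [cP _] [[x [xP ux Px]] _ [y [yP ay _]] _] _].
split; rewrite ?inE ?eqxx //.
- by rewrite negb_or eq_sym au.
- by apply: (connectedU (@connected1 G a) cP (set11 a) yP); rewrite ay orbT.
- exists x; split=> // [|z]; first by rewrite !inE xP orbT.
  by rewrite !inE => /predU1P [->|/Px//]; rewrite (negbTE nua).
Qed.

Section Attachment.
Variables (G : sgraph T) (u : T) (I : {set T}).
Hypotheses (cI : connected G I) (uI : u \notin I).
Hypothesis Iu : forall z, z \in I -> ~~ adj G u z.
Hypothesis IW : forall z, z \in I -> z \notin hole_nbhd G u.

(** [I] stands for the interior of a supposed hole of [lchord G u] through [u], and attached
    vertices for the two neighbours of [u] on it. *)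
Definition attached a := exists2 i, i \in I & adj G a i.

(* Otherwise A, I and B together close up to a hole through u that meets I. *)
Lemma legs_touch a b A B : attached a -> attached b ->
  leg G u a A -> leg G u b B -> touch G A B.
Proof.
case=> i iI ai [j jI bj] [aA uA cA [x [xA ux Ax]]] [bB uB cB [y [yB uy By]]].
case: (boolP (touch G A B)) => // nt.
have ntP s t : s \in A -> t \in B -> (s == t) || adj G s t -> False.
  by move=> sA tB st; case/touchP: nt; exists s, t.
have xy : x != y by apply/negP => xy; apply: (ntP x y); rewrite ?xy.
have nxy : ~~ adj G x y by apply/negP => nxy; apply: (ntP x y); rewrite ?nxy ?orbT.
pose S := A :|: I :|: B.
have cS : connected G S.
  apply: (connectedU (a := j) (b := b)) => //; last by rewrite adjC bj orbT.
    by apply: (connectedU (a := a) (b := i)); rewrite ?ai ?orbT.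
  by rewrite inE jI orbT.
have xS : x \in S by rewrite !inE xA.
have yS : y \in S by rewrite !inE yB !orbT.
have [||H [hH sH [uH xH yH] cH]] := apex_hole _ xS yS ux uy xy nxy _ (cS _ _ xS yS).
- by rewrite !inE !negb_or uA uI.
- move=> z; rewrite !inE => /orP [/orP [zA|zI]|zB] uz; [left|exfalso|right]; auto.
  by move: (Iu zI); rewrite uz.
exfalso; case: (set_0Vmem (H :&: I)) => [HI|[z /setIP [zH zI]]]; last first.
  by case/hole_nbhdP: (IW zI); exists H.
apply: (ntP y y); rewrite ?eqxx //.
apply: (conn_closed _ cH xA) => s t sA /setD1P [tu tH] st.
have := subsetP sH _ tH; rewrite !inE (negbTE tu) /= => /orP [/orP [//|tI]|tB].
  by have := in_set0 t; rewrite -HI inE tH tI.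
by case: (ntP s t); rewrite ?st ?orbT.
Qed.

(** Suppose [a] and [b] are distinct and nonadjacent. Legs of [a] touch legs of [b], and [nc_touch]
    is used twice: with apex [b], to show that every leg of [a] touches [b] itself, then with apex
    [a] and the singleton of [b] as [X]. *)
Lemma nc_attached a b : NC_vertex G u -> attached a -> attached b ->
  a != u -> b != u -> adj G u a || (a \in hole_nbhd G u) ->
  adj G u b || (b \in hole_nbhd G u) -> (a == b) || adj G a b.
Proof.
move=> nc aI bI au bu wa wb; case: (boolP (_ || _)) => //.
case/norP=> ab nab; exfalso.
have legA A : leg G u a A -> touch G A [set b].
  move=> lA; case: (boolP (adj G u b)) wb => [ub _|nub /= /hole_nbhdP [H [hH uH bH]]].
    exact: legs_touch aI bI lA (leg1 ub).
  have [P [Q arcPQ]] := hole_arcs hH uH bH bu nub.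
  case: (boolP (touch G A [set b])) => // nt; exfalso.
  have ntP s : s \in A -> (s == b) || adj G s b -> False.
    by move=> sA sb; case/touchP: nt; exists s, b; rewrite inE.
  have arcT P' Q' : arcs G H u b P' Q' -> touch G P' A.
    move=> arcP; rewrite touchC.
    have /touchP [s [t [sA tB st]]] := legs_touch aI bI lA (arc_leg bu nub arcP).
    case/setU1P: tB st => [-> /(ntP _ sA) []|tP st].
    by apply/touchP; exists s, t.
  case: lA => aA uA cA _.
  apply: (nc_touch nc hH uH bH bu arcPQ cA uA) => [|z zA||].
  - by apply/negP => bA; apply: (ntP b); rewrite ?eqxx.
  - by apply/negP => bz; apply: (ntP z); rewrite // adjC bz orbT.
  - exact: arcT arcPQ.
  - exact: arcT (arcsC arcPQ).
case: (boolP (adj G u a)) wa => [ua _|nua /= /hole_nbhdP [H [hH uH aH]]].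
  have /touchP [s [t []]] := legA _ (leg1 ua).
  by rewrite !inE => /eqP -> /eqP ->; rewrite (negbTE ab) (negbTE nab).
have [P [Q arcPQ]] := hole_arcs hH uH aH au nua.
have arcT P' Q' : arcs G H u a P' Q' -> touch G P' [set b].
  move=> /(arc_leg au nua) /legA /touchP [s [t [sA]]]; rewrite inE => /eqP ->.
  case/setU1P: sA => [->|sP st]; first by rewrite (negbTE ab) (negbTE nab).
  by apply/touchP; exists s, b; rewrite inE.
apply: (nc_touch nc hH uH aH au arcPQ (@connected1 G b)).
- by rewrite inE eq_sym.
- by rewrite inE.
- by move=> z; rewrite inE => /eqP ->.
- exact: arcT arcPQ.
- exact: arcT (arcsC arcPQ).
Qed.
End Attachment.

(** * Holes and added edges under local chordalization *)

Lemma hole_nbhd_verts G u w : w \in hole_nbhd G u -> (u \in verts G) && (w \in verts G).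
Proof. by case/hole_nbhdP=> H [/and4P [/subsetP sH _ _ _] uH wH]; rewrite !sH. Qed.

Lemma hole_nbhdC G u w : (u \in hole_nbhd G w) = (w \in hole_nbhd G u).
Proof. by apply/hole_nbhdP/hole_nbhdP => -[H []]; exists H. Qed.

Lemma adj_lchord G u x y : adj (lchord G u) x y = adj G x y ||
  (x != y) && ((x == u) && (y \in hole_nbhd G u) || (y == u) && (x \in hole_nbhd G u)).
Proof.
rewrite /adj /=; case: (x != y); rewrite ?andbF //=.
have hx : (x == u) && (y \in hole_nbhd G u) -> (x \in verts G) && (y \in verts G).
  by case/andP=> /eqP -> /hole_nbhd_verts.
have hy : (y == u) && (x \in hole_nbhd G u) -> (x \in verts G) && (y \in verts G).
  by case/andP=> /eqP -> /hole_nbhd_verts; rewrite andbC.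
move: hx hy; case: (_ && (y \in _)); case: (_ && (x \in _)); rewrite ?orbF //= ?orbT ?andbT.
- by move=> /(_ isT) /andP [-> ->].
- by move=> /(_ isT) /andP [-> ->].
- by move=> _ /(_ isT) /andP [-> ->].
Qed.

Lemma adj_lchord_out G u x y : x != u -> y != u -> adj (lchord G u) x y = adj G x y.
Proof. by move=> xu yu; rewrite adj_lchord (negbTE xu) (negbTE yu) andbF orbF. Qed.

Lemma eq_hole G G' H : {in H &, adj G =2 adj G'} -> H \subset verts G' ->
  hole G H -> hole G' H.
Proof.
move=> eqG sH /and4P [_ c4 /forall_inP d /forallP cH]; apply/and4P; split=> //.
  apply/forall_inP => x xH; rewrite -(eqP (d x xH)); apply/eqP/eq_card => y.
  by rewrite !inE; case yH: (y \in H); rewrite //= eqG.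
apply/forallP => B; apply/implyP => /and3P [sB B0 /forall_inP cB].
apply: (implyP (cH B)); rewrite sB B0; apply/forall_inP => x xB.
apply/forall_inP => y yH; rewrite eqG ?(subsetP sB x) //.
by move/forall_inP: (cB x xB); apply.
Qed.

Lemma hole_lchord_out G u H : u \notin H -> hole (lchord G u) H = hole G H.
Proof.
move=> uH.
have E : {in H &, adj (lchord G u) =2 adj G}.
  move=> x y xH yH; apply: adj_lchord_out.
    by apply: contraNneq uH => <-.
  by apply: contraNneq uH => <-.
apply/idP/idP => hH; case/and4P: (hH) => sH _ _ _; apply: eq_hole hH => //.
by move=> x y xH yH; rewrite E.
Qed.

(** On such a hole through [u], the neighbours [a] and [b] of [u] are nonadjacent and are joined by
    an interior with no neighbour of [u], old or new; but [nc_attached] makes [a] and [b]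
    adjacent. *)
Lemma nc_lchord_hole G u H : NC_vertex G u -> hole (lchord G u) H -> u \notin H.
Proof.
move=> nc hH; apply/negP => uH.
have [p [unp up lp szp eH]] := hole_cycle hH uH.
case: p unp up lp szp eH => // a p; case/lastP: p => // m b unp up lp szp eH.
have [um ma mb [au bu ab]] : [/\ u \notin m, a \notin m, b \notin m & [/\ a != u, b != u & a != b]].
  move: unp => /= /and3P []; rewrite !(inE, mem_rcons) !negb_or rcons_uniq.
  case/and3P=> ua ub um /andP [ab am] /andP [bm _].
  by rewrite (eq_sym a) (eq_sym b).
have inH z : (z \in H) = [|| z == u, z == a, z == b | z \in m].
  by rewrite eH !(inE, mem_rcons).
have aH : a \in H by rewrite inH eqxx orbT.
have bH : b \in H by rewrite inH eqxx !orbT.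
have m_neq z : z \in m -> [/\ z != u, z != a & z != b].
  by move=> zm; split; [apply: contraNneq um|apply: contraNneq ma|apply: contraNneq mb] => <-.
case: m um ma mb inH m_neq szp up lp {unp eH} => [//|c m] um ma mb inH m_neq _ up lp.
have mH z : z \in c :: m -> z \in H by rewrite inH => ->; rewrite !orbT.
move: up lp; rewrite /= rcons_path last_rcons => /and4P [ua ac cm lb] bu'.
rewrite adjC in bu'.
have nbu z : z \in H -> adj (lchord G u) u z -> z = a \/ z = b.
  by move=> zH uz; apply: (hole_deg hH uH).
have cu : u != c by rewrite eq_sym; case: (m_neq c (mem_head _ _)).
have nab : ~~ adj (lchord G u) a b.
  apply/negP => a_b; rewrite adjC in ua.
  case: (hole_deg hH aH uH (mH _ (mem_head _ _)) bH ua ac a_b cu) => e.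
    by rewrite e eqxx in bu.
  by rewrite e mem_head in mb.
have Inu z : z \in c :: m -> ~~ adj (lchord G u) u z.
  move=> zm; apply/negP => /(nbu _ (mH _ zm)); case: (m_neq z zm) => _ za zb.
  by case=> e; rewrite e eqxx in za zb.
have wu z : adj (lchord G u) u z -> adj G u z || (z \in hole_nbhd G u).
  by rewrite adj_lchord => /orP [->//|/andP [_ /orP []/andP [/eqP]]];
    [move=> _ ->; rewrite orbT | move=> -> ->; rewrite orbT].
have mout x y : x != u -> y != u -> adj (lchord G u) x y -> adj G x y.
  by move=> xu yu; rewrite adj_lchord_out.
have cI : connected G [set z in c :: m].
  apply: connected_seq; apply: (sub_in_path (P := predC1 u)) cm.
    by move=> x y /= xu yu; apply: mout.
  by apply/allP => z /m_neq [].
have lm := mem_last c m.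
have := @nc_attached G u [set z in c :: m] cI _ _ _ a b nc.
rewrite (negbTE ab) /= => attI.
suff : adj G a b by rewrite -(adj_lchord_out G au bu) (negbTE nab).
apply: attI => //.
- by rewrite in_set.
- by move=> z; rewrite in_set => /Inu; rewrite adj_lchord negb_or => /andP [].
- move=> z; rewrite in_set => zm; have [zu _ _] := m_neq z zm.
  move: (Inu z zm); rewrite adj_lchord negb_or eq_sym zu eqxx /= => /andP [_].
  by rewrite negb_or => /andP [].
- by exists c; rewrite ?in_set ?mem_head // mout // eq_sym.
- exists (last c m); rewrite ?in_set // mout // 1?adjC //.
  by case: (m_neq _ lm).
- exact: wu.
- exact: wu.
Qed.

Lemma NC_set_eq G C H u v : NC_set G C -> hole G H -> u \in H -> v \in H ->
  u \in C -> v \in C -> u = v.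
Proof.
move=> [_ nc] hH uH vH uC vC; apply: contraTeq (nc H hH) => uv.
rewrite -ltnNge (leq_trans _ (subset_leq_card (_ : [set u; v] \subset _))) //.
  by rewrite cards2 uv.
by apply/subsetP => z; rewrite !inE => /orP [] /eqP ->; apply/andP.
Qed.

(** Every added edge ends at [u], so a hole missing [u] was a hole before; [nc_lchord_hole] excludes
    the others. *)
Lemma hole_lchord G u H : NC_vertex G u -> hole (lchord G u) H -> hole G H /\ u \notin H.
Proof. by move=> nc hH; have uH := nc_lchord_hole nc hH; rewrite -(hole_lchord_out G uH). Qed.

(** The remaining holes are old ones avoiding [u], where adjacency is unchanged, so a violation
    would already occur in [G]. *)
Lemma NC_lchord G C u : NC_set G C -> u \in C -> NC_set (lchord G u) C.
Proof.
move=> ncC uC; have [nc1 nc2] := ncC; have ncu := nc1 u uC; split.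
  move=> v vC [H [H' [/(hole_lchord ncu) [hH uH] vH /(hole_lchord ncu) [hH' _] vH' sh]]].
  apply: (nc1 v vC); exists H, H'; split=> //.
  case: sh => a [b [c [aH bH cH ac /andP [ab bc]]]].
  have nu z : z \in H :&: H' -> z != u.
    by case/setIP=> zH _; apply: contraNneq uH => <-.
  by exists a, b, c; split=> //; rewrite -!(@adj_lchord_out G u) ?nu ?ab.
by move=> H /(hole_lchord ncu) [hH _]; apply: nc2.
Qed.

Lemma verts_foldl_lchord G s : verts (foldl (@lchord T) G s) = verts G.
Proof. by elim: s G => //= u s IH G; rewrite IH. Qed.

Lemma verts_hatG G C : verts (hatG G C) = verts G.
Proof. exact: verts_foldl_lchord. Qed.

Lemma adj_sub_hatG G C x y : adj G x y -> adj (hatG G C) x y.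
Proof.
rewrite /hatG; elim: (enum C) G => //= u s IH G xy.
by apply: IH; rewrite adj_lchord xy.
Qed.

(** Each added edge comes from a hole of an intermediate graph, which by [hole_lchord] is a hole of
    [G]; so added edges can be read off [G] alone. *)
Lemma adj_hatG G C x y : NC_set G C -> adj (hatG G C) x y ->
  adj G x y \/ (x \in C \/ y \in C) /\ y \in hole_nbhd G x.
Proof.
rewrite /hatG => ncC; have : {subset enum C <= C} by move=> z; rewrite mem_enum.
elim: (enum C) (enum_uniq C) G ncC => [|u s IH] /=; first by left.
case/andP=> us uqs G ncC sC.
have uC : u \in C by apply: sC; rewrite mem_head.
have sC' : {subset s <= C} by move=> z zs; apply: sC; rewrite inE zs orbT.
case/(IH uqs _ (NC_lchord ncC uC) sC') => [|[xyC]].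
  rewrite adj_lchord => /orP [->|/andP [_ /orP [] /andP [/eqP -> W]]]; [by left| |]; right.
    by split; [left|].
  by split; [right|rewrite hole_nbhdC].
have [xu|xu] := eqVneq x u.
  by move=> /hole_nbhdP [H [/(hole_lchord (ncC.1 u uC)) [_ uH] xH _]]; rewrite -xu xH in uH.
case/hole_nbhdP=> H [/(hole_lchord (ncC.1 u uC)) [hH _] xH yH].
by right; split=> //; apply/hole_nbhdP; exists H.
Qed.

(** A hole through [u] and [w] misses [v], having at most one vertex in [C]. If both its arcs
    touched [v], [nc_touch] with apex [w] would give a contradiction. *)
Lemma free_arc G C u v w : NC_set G C -> u \in C -> v \in C -> v != u -> w != u -> w != v ->
  w \in hole_nbhd G u -> ~~ adj G u w -> ~~ adj G v w ->
  exists P, [/\ [/\ u \notin P, v \notin P & w \notin P], connected G P, one_nbr G u P,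
    one_nbr G w P & forall z, z \in P -> ~~ adj G v z].
Proof.
move=> ncC uC vC vu wu wv /hole_nbhdP [H [hH uH wH]] nuw nvw.
have vH : v \notin H.
  by apply: contraNN vu => vH; apply/eqP; apply: NC_set_eq ncC hH vH uH vC uC.
have [P [Q arcPQ]] := hole_arcs hH uH wH wu nuw.
have arcP P' Q' : arcs G H u w P' Q' -> ~~ touch G P' [set v] ->
  exists P, [/\ [/\ u \notin P, v \notin P & w \notin P], connected G P, one_nbr G u P,
    one_nbr G w P & forall z, z \in P -> ~~ adj G v z].
  case=> [[sP _ _] [uP _ wP _] [cP _] [u1 _ w1 _] _] nt; exists P'; split=> //.
    by split=> //; apply: contraNN vH => /(subsetP sP).
  move=> z zP; apply: contraNN nt => vz; apply/touchP; exists z, v.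
  by rewrite inE adjC vz orbT.
case: (boolP (touch G P [set v])) => [tP|]; last exact: arcP arcPQ.
case: (boolP (touch G Q [set v])) => [tQ|]; last exact: arcP (arcsC arcPQ).
case: (nc_touch (ncC.1 u uC) hH uH wH wu arcPQ (@connected1 G v) _ _ _ tP tQ).
- by rewrite inE eq_sym.
- by rewrite inE.
- by move=> z; rewrite inE => /eqP ->; rewrite adjC.
Qed.

(** Otherwise a free arc from [u] to [w] and one from [w] to [v], closed by the edge between [u] and
    [v], yield a hole with two vertices in [C]. *)
Lemma NC_common_nbhd G C u v w : NC_set G C -> u \in C -> v \in C -> adj G u v ->
  w != u -> w != v -> w \in hole_nbhd G u -> w \in hole_nbhd G v ->
  adj G u w || adj G v w.
Proof.
move=> ncC uC vC uv wu wv wWu wWv; case: (boolP (_ || _)) => // /norP [nuw nvw].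
have uv' := adj_neq uv; have vu : v != u by rewrite eq_sym.
have [P [[uP vP wP] cP [x [xP ux Px]] [x' [x'P wx' _]] nvP]] :=
  free_arc ncC uC vC vu wu wv wWu nuw nvw.
have [Q [[vQ uQ wQ] cQ [y [yQ vy Qy]] [y' [y'Q wy' _]] nuQ]] :=
  free_arc ncC vC uC uv' wv wu wWv nvw nuw.
pose S := P :|: ([set w] :|: Q) :|: [set v].
have cS : connected G S.
  apply: (connectedU (a := y) (b := v)); rewrite ?inE ?yQ ?orbT //.
  - apply: (connectedU (a := x') (b := w)); rewrite ?inE ?eqxx ?x'P //.
      apply: (connectedU (a := w) (b := y')); rewrite ?inE ?wy' ?orbT //; exact: connected1.
    by rewrite adjC wx' orbT.
  - exact: connected1.
  - by rewrite adjC vy orbT.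
have xS : x \in S by rewrite !inE xP.
have vS : v \in S by rewrite !inE eqxx !orbT.
have xv : x != v by apply: contraNneq vP => <-.
have nxv : ~~ adj G x v by rewrite adjC nvP.
have [||H [hH _ [uH _ vH] _]] := apex_hole _ xS vS ux uv xv nxv _ (cS _ _ xS vS).
- by rewrite !inE !negb_or uP uQ uv' eq_sym wu.
- move=> z; rewrite !inE => /orP [/orP [zP|/predU1P [->|zQ]]|/eqP ->] uz.
  + by left; apply: Px.
  + by rewrite uz in nuw.
  + by move: (nuQ z zQ); rewrite uz.
  + by right.
by have := NC_set_eq ncC hH uH vH uC vC => e; rewrite e eqxx in uv'.
Qed.

Lemma four_hole G a b c d : adj G a b -> adj G b c -> adj G c d -> adj G d a ->
  a != c -> b != d -> ~~ adj G a c -> ~~ adj G b d ->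
  exists H, [/\ hole G H, a \in H & b \in H].
Proof.
move=> ab bc cd da ac bd nac nbd; rewrite adjC in da.
pose S := [set z in [:: b; c; d]].
have cS : connected G S by apply: connected_seq; rewrite /= bc cd.
have bS : b \in S by rewrite !inE eqxx.
have dS : d \in S by rewrite !inE eqxx !orbT.
have [||H [hH _ [aH bH _] _]] := apex_hole _ bS dS ab da bd nbd _ (cS _ _ bS dS).
- by rewrite !inE !negb_or ac (adj_neq ab) (adj_neq da).
- move=> z; rewrite !inE => /or3P [] /eqP ->; auto.
  by move=> h; rewrite h in nac.
by exists H.
Qed.

(* Two added edges uw, u'w' with u != u' cannot lie in a common clique: if u'w
   (or uw') is added as well, NC_common_nbhd applies; otherwise u, u', w, w'
   is a hole with two vertices in C. *)
Lemma clique_hatG G C K : NC_set G C -> clique (hatG G C) K -> K != set0 ->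
  exists u, [/\ u \in K, clique G (K :\ u) &
    forall w, w \in K -> w != u -> adj G u w || (w \in hole_nbhd G u)].
Proof.
move=> ncC /andP [sK /forall_inP cK] /set0Pn [u0 u0K].
rewrite verts_hatG in sK.
have adjK x y : x \in K -> y \in K -> x != y -> adj (hatG G C) x y.
  by move=> xK yK xy; move/forall_inP: (cK x xK) => /(_ y yK)/implyP; apply.
have newK x y : x \in K -> y \in K -> x != y -> ~~ adj G x y ->
    (x \in C \/ y \in C) /\ y \in hole_nbhd G x.
  by move=> xK yK xy /negbTE nxy; case: (adj_hatG ncC (adjK _ _ xK yK xy)) => //; rewrite nxy.
have W_C x y : x \in C -> y \in hole_nbhd G x -> x != y -> y \notin C.
  move=> xC /hole_nbhdP [H [hH xH yH]] xy; apply: contraNN xy => yC.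
  by apply/eqP; apply: NC_set_eq ncC hH xH yH xC yC.
(* Does [K] contain an added edge? If not, it is a clique of [G] and any of its vertices serves as
   [u]. *)
case: (boolP [exists u in K, exists w in K,
    [&& u \in C, u != w, w \in hole_nbhd G u & ~~ adj G u w]]); last first.
  move=> none; have allK x y : x \in K -> y \in K -> x != y -> adj G x y.
    move=> xK yK xy; case: (boolP (adj G x y)) => // nxy.
    have [xyC W] := newK _ _ xK yK xy nxy.
    case/negP: none; case: xyC => [xC|yC].
      by apply/exists_inP; exists x => //; apply/exists_inP; exists y => //; apply/and4P.
    apply/exists_inP; exists y => //; apply/exists_inP; exists x => //; apply/and4P.
    by rewrite eq_sym hole_nbhdC adjC.
  exists u0; split=> // [|w wK wu]; last by rewrite allK // eq_sym.
  apply/andP; split; first by apply: subset_trans sK; apply: subD1set.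
  apply/forall_inP => x /setD1P [_ xK]; apply/forall_inP => y /setD1P [_ yK].
  by apply/implyP; apply: allK.
case/exists_inP=> u uK /exists_inP [w wK /and4P [uC uw wW nuw]].
have wu : w != u by rewrite eq_sym.
have wC := W_C _ _ uC wW uw.
exists u; split=> //; last first.
  move=> x xK xu; case: (boolP (adj G u x)) => //= nux.
  by case: (newK u x) => //; rewrite eq_sym.
apply/andP; split; first by apply: subset_trans sK; apply: subD1set.
have noK u' w' : u' \in K -> w' \in K -> u' != u -> w' != u -> u' != w' -> u' \in C ->
    w' \in hole_nbhd G u' -> adj G u' w'.
  move=> u'K w'K u'u w'u u'w' u'C w'W; case: (boolP (adj G u' w')) => // nu'w'; exfalso.
  have uu' : adj G u u'.
    case: (boolP (adj G u u')) => // nuu'; have [|_ W] := newK _ _ uK u'K _ nuu'.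
      by rewrite eq_sym.
    by move: (W_C _ _ uC W); rewrite eq_sym u'u u'C => /(_ isT).
  have w'C := W_C _ _ u'C w'W u'w'.
  have w'u' : w' != u' by rewrite eq_sym.
  have wu' : w != u' by apply: contraNneq wC => ->.
  have u'w : adj G u' w.
    case: (boolP (adj G u' w)) => // nu'w; have [|_ W] := newK _ _ u'K wK _ nu'w.
      by rewrite eq_sym.
    by have := NC_common_nbhd ncC uC u'C uu' wu wu' wW W; rewrite (negbTE nuw) (negbTE nu'w).
  have uw' : adj G u w'.
    case: (boolP (adj G u w')) => // nuw'; have [|_ W] := newK _ _ uK w'K _ nuw'.
      by rewrite eq_sym.
    by have := NC_common_nbhd ncC uC u'C uu' w'u w'u' W w'W; rewrite (negbTE nuw') (negbTE nu'w').
  have ww' : adj G w w'.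
    case: (boolP (adj G w w')) => // nww'; have [|[] h _] := newK _ _ wK w'K _ nww'.
    - by apply: contraNneq nuw => ->.
    - by rewrite h in wC.
    - by rewrite h in w'C.
  rewrite adjC in uw'.
  have [H [hH uH u'H]] := four_hole uu' u'w ww' uw' uw u'w' nuw nu'w'.
  by have e := NC_set_eq ncC hH uH u'H uC u'C; rewrite e eqxx in u'u.
apply/forall_inP => x /setD1P [xu xK]; apply/forall_inP => y /setD1P [yu yK].
apply/implyP => xy; case: (boolP (adj G x y)) => // nxy.
have [[xC|yC] W] := newK _ _ xK yK xy nxy.
  by rewrite -(negbTE nxy); apply: noK.
by rewrite -(negbTE nxy) adjC; apply: noK; rewrite // 1?eq_sym // hole_nbhdC.
Qed.

Lemma cliqueP G K : reflect (K \subset verts G /\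
    forall x y, x \in K -> y \in K -> x != y -> adj G x y) (clique G K).
Proof.
apply: (iffP andP) => -[sK cK]; split=> //.
  move=> x y xK yK xy; move/forall_inP: cK => /(_ x xK)/forall_inP/(_ y yK)/implyP.
  exact.
by apply/forall_inP => x xK; apply/forall_inP => y yK; apply/implyP; apply: cK.
Qed.

Definition component G S x := [set y | conn G S x y].

Lemma component_sub G S x : x \in S -> component G S x \subset S.
Proof.
by move=> xS; apply/subsetP => y; rewrite inE => xy; apply: conn_closed xy xS.
Qed.

Lemma component_root G S x : x \in component G S x.
Proof. by rewrite inE; apply: connect0. Qed.

Lemma component_closed G S x y z : x \in S -> y \in component G S x -> z \in S ->
  adj G y z -> z \in component G S x.
Proof.
move=> xS yC zS yz; have yS := subsetP (component_sub G xS) _ yC.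
by move: yC; rewrite !inE => xy; apply: conn_trans xy _; apply: conn_adj.
Qed.

Lemma component_connected G S x : x \in S -> connected G (component G S x).
Proof.
move=> xS; have sC := component_sub G xS.
have xC z : z \in component G S x -> conn G (component G S x) x z.
  rewrite inE => xz.
  have: z \in [set z | conn G (component G S x) x z]; last by rewrite inE.
  apply: (conn_closed _ xz); last by rewrite inE; apply: connect0.
  move=> a b; rewrite !inE => xa bS ab.
  have aC : a \in component G S x by rewrite inE; apply: conn_sub sC xa.
  by apply: conn_trans xa _; apply: conn_adj (component_closed xS aC bS ab) ab.
by move=> y z yC zC; apply: (conn_trans (y := x)); rewrite ?xC // conn_sym xC.
Qed.

(** * Clique minors *)

(** A clique minor whose branch sets are indexed by their own representatives and confined to [V]: a
    vertex outside [V] adjacent to all of [L] is then adjacent to every branch set and disjoint from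
    it. *)
Definition rooted_minor G V L := exists B : T -> {set T},
  (forall x, x \in L -> [/\ x \in B x, B x \subset V & connb G (B x)]) /\
  (forall x y, x \in L -> y \in L -> x != y -> [disjoint B x & B y] /\
     exists s t, [/\ s \in B x, t \in B y & adj G s t]).

Lemma rooted_minor_Kminor G V L n :
  V \subset verts G -> rooted_minor G V L -> n <= #|L| -> has_Kminor G n.
Proof.
move=> sV [B [B1 B2]] nL.
pose f (i : 'I_n) := enum_val (widen_ord nL i).
have fL i : f i \in L by apply: enum_valP.
exists (fun i => B (f i)); split=> [i|i j ij].
  have [fB BV cB] := B1 _ (fL i); split=> //; last exact: subset_trans sV.
  by apply/set0Pn; exists (f i).
apply: B2 => //; apply: contraNneq ij => /enum_val_inj e.
by apply/eqP/val_inj; rewrite /= -[RHS]/(val (widen_ord nL j)) -e.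
Qed.

Lemma connb_mono G G' A : (forall x y, adj G x y -> adj G' x y) -> connb G A -> connb G' A.
Proof.
move=> sG /forallP cA; apply/forallP => B; apply/implyP => /and3P [sB B0 /forall_inP cB].
apply: (implyP (cA B)); rewrite sB B0; apply/forall_inP => x xB; apply/forall_inP => y yA.
apply/implyP => /sG xy; move/forall_inP: (cB x xB) => /(_ y yA)/implyP; exact.
Qed.

Lemma rooted_minor_mono G G' V L : (forall x y, adj G x y -> adj G' x y) ->
  rooted_minor G V L -> rooted_minor G' V L.
Proof.
move=> sG [B [B1 B2]]; exists B; split=> [x xL|x y xL yL xy].
  by have [? ? cB] := B1 x xL; split=> //; apply: connb_mono cB.
by have [dB [s [t [sB tB st]]]] := B2 x y xL yL xy; split=> //;
  exists s, t; split=> //; apply: sG.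
Qed.

Lemma rooted_minor0 G V : rooted_minor G V set0.
Proof. by exists (fun x => [set x]); split=> [x|x y]; rewrite in_set0. Qed.

(** The closure property shared by cliques and rooted minors, so that one induction over the parts
    serves both bounds. *)
Definition extendable G (good : {set T} -> {set T} -> Prop) :=
  forall V V' L, V \subset V' -> L \subset V' -> good V (L :&: V) ->
  (forall x y, x \in L -> y \in L -> y \notin V -> x != y -> adj G x y) -> good V' L.

(** New vertices become singleton branch sets; adjacency to the roots suffices, and the old sets
    stay inside [V]. *)
Lemma rooted_minor_extend G : extendable G (rooted_minor G).
Proof.
move=> V V' L sV sL [B [B1 B2]] adjL.
pose B' x := if x \in V then B x else [set x].
have LV x : x \in L -> x \in V -> x \in L :&: V by rewrite inE => -> ->.
have xB' x : x \in L -> x \in B' x.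
  rewrite /B'; case: ifP => xV xL; last by rewrite inE.
  by case: (B1 x (LV x xL xV)).
exists B'; split=> [x xL|x y xL yL xy].
  split; first exact: xB'.
    rewrite /B'; case: ifP => xV; last by rewrite sub1set (subsetP sL).
    by case: (B1 x (LV x xL xV)) => _ sB _; apply: subset_trans sV.
  rewrite /B'; case: ifP => xV; last exact/connected_connb/connected1.
  by case: (B1 x (LV x xL xV)).
have BV z w : z \in L -> z \in V -> w \notin V -> w \notin B z.
  by move=> zL zV; apply: contraNN => wB; case: (B1 z (LV z zL zV)) => _ /subsetP /(_ w wB).
case xV: (x \in V); case yV: (y \in V).
- by rewrite /B' xV yV; apply: B2; rewrite // LV.
- split; last by exists x, y; rewrite !xB' // adjL // yV.
  by rewrite /B' xV yV disjoint_sym disjoints1 BV // yV.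
- split; last by exists x, y; rewrite !xB' // adjC adjL // 1?eq_sym // xV.
  by rewrite /B' xV yV disjoints1 BV // xV.
- split; last by exists x, y; rewrite !xB' // adjL // yV.
  by rewrite /B' xV yV disjoints1 inE.
Qed.

(* The hole through u and a non-neighbour w has two arcs; both cannot meet the
   clique K :\ u, so u reaches w outside it. *)
Lemma clique_hole_nbhd_minor G K u : u \in K -> u \in verts G -> clique G (K :\ u) ->
  (forall w, w \in K -> w != u -> adj G u w || (w \in hole_nbhd G u)) ->
  rooted_minor G (verts G) K.
Proof.
move=> uK uV /cliqueP [sK cK] nbK.
(* [V'] keeps [u] and drops the rest of [K], so the component of [u] in it is a branch set disjoint
   from the singletons of the others. *)
pose V' := verts G :\: (K :\ u).
have uV' : u \in V' by rewrite !inE eqxx uV.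
pose B x := if x == u then component G V' u else [set x].
have sC := component_sub G uV'.
have xB x : x \in B x by rewrite /B; case: eqP => [->|_]; [apply: component_root|apply: set11].
have reach w : w \in K -> w != u -> exists s, s \in component G V' u /\ adj G s w.
  move=> wK wu; case: (boolP (adj G u w)) (nbK w wK wu) => [uw _|nuw /=].
    by exists u; split=> //; apply: component_root.
  case/hole_nbhdP=> H [hH uH wH].
  have [P [Q arcPQ]] := hole_arcs hH uH wH wu nuw.
  suff [P' [Q' [arcP disP]]] : exists P' Q', arcs G H u w P' Q' /\ P' :&: K = set0.
    case: arcP => [[sP _ _] [uP _ _ _] [cP _] [[x [xP ux _]] _ [y [yP wy _]] _] _].
    have sPV : P' \subset V'.
      apply/subsetP => z zP; rewrite !inE negb_and negbK.
      have -> : z \notin K.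
        by apply/negP => zK; have := in_set0 z; rewrite -disP inE zP zK.
      rewrite orbT /=; case/and4P: hH => /subsetP sH _ _ _.
      by apply/sH/(subsetP sP).
    exists y; split; last by rewrite adjC.
    rewrite inE; apply: (conn_trans (y := x)).
      by apply: conn_adj ux => //; apply: (subsetP sPV).
    by apply: conn_sub sPV _; apply: cP.
  case: (set_0Vmem (P :&: K)) => [e|[x /setIP [xP xK]]]; first by exists P, Q.
  case: (set_0Vmem (Q :&: K)) => [e|[y /setIP [yQ yK]]].
    by exists Q, P; split=> //; apply: arcsC.
  case: arcPQ => [[_ _ dPQ] [uP uQ _ _] _ _ /(_ x y xP yQ)]; rewrite cK //.
  - by rewrite !inE xK andbT; apply: contraNneq uP => <-.
  - by rewrite !inE yK andbT; apply: contraNneq uQ => <-.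
  - by apply: contraTneq yQ => <-; rewrite (disjointFr dPQ xP).
have KC w : w \in K -> w != u -> w \notin component G V' u.
  by move=> wK wu; apply/negP => /(subsetP sC); rewrite !inE wu wK.
exists B; split=> [x xK|x y xK yK xy].
  split; first exact: xB.
    rewrite /B; case: eqP => [_|/eqP xu].
      by apply: subset_trans sC _; apply: subsetDl.
    by rewrite sub1set (subsetP sK) // !inE xu.
  rewrite /B; case: eqP => _; apply: connected_connb; last exact: connected1.
  exact: component_connected.
have [xu|xu] := eqVneq x u; have [yu|yu] := eqVneq y u.
- by rewrite xu yu eqxx in xy.
- have [s [sC' sy]] := reach y yK yu.
  rewrite /B xu eqxx (negbTE yu) disjoint_sym disjoints1 KC //; split=> //.
  by exists s, y; rewrite inE.
- have [s [sC' sx]] := reach x xK xu.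
  rewrite /B yu eqxx (negbTE xu) disjoints1 KC //; split=> //.
  by exists x, s; rewrite inE adjC.
- split; first by rewrite /B (negbTE xu) (negbTE yu) disjoints1 inE.
  by exists x, y; rewrite !xB cK // !inE ?xu ?yu.
Qed.

(** * Local chordalization partitions *)

Section Chain.
Variables (G : sgraph T) (good : {set T} -> {set T} -> Prop).
Hypothesis good_extend : extendable G good.

(** The invariant of the induction over the parts: [k] is the number of vertices a clique may have
    gained so far. The first clause makes [F] a supergraph of [G] once all vertices are back. *)
Definition near_good F k :=
  (forall x y, x \in verts F -> y \in verts F -> adj G x y -> adj F x y) /\
  (forall K, clique F K -> exists D, #|D| <= k /\ good (verts F) (K :\: D)).

Definition lcp_next F C R := SGraph (verts F :|: C)
  (fun x y => adj F x y || adj (delv G R) x y).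

Lemma adj_lcp_next F C R x y : adj (lcp_next F C R) x y -> adj F x y \/ adj G x y.
Proof.
have dG a b : adj (delv G R) a b -> adj G a b.
  by case/and4P; rewrite /= !inE => /andP [_ aV] /andP [_ bV] ab E; rewrite /adj aV bV ab.
case/and4P=> _ _ _ /= /orP [] /orP [|/dG]; rewrite ?[adj _ y x]adjC; auto.
Qed.

Lemma adj_sub_lcp_next F C R x y : [disjoint verts F :|: C & R] ->
  x \in verts F :|: C -> y \in verts F :|: C -> adj G x y -> adj (lcp_next F C R) x y.
Proof.
move=> dR xV yV xy; have [xG yG xy' E] := and4P xy.
rewrite /adj /= xV yV xy' /=; apply/orP; left; apply/orP; right.
by rewrite /adj /= !inE xG yG xy' E (disjointFr dR xV) (disjointFr dR yV).
Qed.

(** [clique_hatG] takes one vertex [u] out of [K]. The rest is a clique of [F] on the old vertices,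
    where [k] deletions suffice; its new vertices are joined to it by edges of [G], so [good_extend]
    puts them back. *)
Lemma near_good_step F k C R : [disjoint verts F :|: C & R] -> NC_set (lcp_next F C R) C ->
  near_good F k -> near_good (hatG (lcp_next F C R) C) k.+1.
Proof.
move=> dR ncC [F1 F2]; split=> [x y|K cK]; rewrite verts_hatG.
  by move=> xV yV xy; apply: adj_sub_hatG; apply: adj_sub_lcp_next.
have sV : verts F \subset verts (lcp_next F C R) := subsetUl _ _.
have [K0|Kn0] := eqVneq K set0.
  have [|D [_ gD]] := F2 set0.
    by apply/cliqueP; split=> [|x y]; rewrite ?sub0set ?inE.
  exists set0; rewrite cards0 K0 setD0; split=> //.
  apply: (good_extend sV) => [||x y]; rewrite ?sub0set ?in_set0 //.
  by rewrite set0I -(set0D D).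
have [u [uK /cliqueP [sK cKu] _]] := clique_hatG ncC cK Kn0.
have [|D [cD gD]] := F2 ((K :\ u) :&: verts F).
  apply/cliqueP; split=> [|x y /setIP [xK xF] /setIP [yK yF] xy]; first exact: subsetIr.
  by case: (adj_lcp_next (cKu _ _ xK yK xy)) => // /F1; apply.
exists (u |: D); split.
  by rewrite cardsU1; case: (u \notin D) => //=; apply: leq_trans cD _.
have KuD x : x \in K :\: (u |: D) -> x \in K :\ u.
  by rewrite !inE negb_or -andbA => /and3P [-> _ ->].
apply: (good_extend sV) => [||x y xL yL yF xy].
- by apply/subsetP => x /KuD /(subsetP sK).
- rewrite (_ : _ :&: _ = (K :\ u) :&: verts F :\: D) //; apply/setP => x.
  by rewrite !inE negb_or; case: (x == u); case: (x \in D); rewrite ?andbF.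
- case: (adj_lcp_next (cKu _ _ (KuD _ xL) (KuD _ yL) xy)) => // /adj_verts.
  by rewrite (negbTE yF) andbF.
Qed.

Lemma disjoint_bigcup A (parts : seq {set T}) :
  all (fun B => [disjoint A & B]) parts -> [disjoint A & \bigcup_(D <- parts) D].
Proof.
elim: parts => [_|B parts IH /= /andP [AB /IH AU]]; rewrite ?big_nil ?big_cons.
  by rewrite disjoints_subset setC0 subsetT.
by rewrite disjoints_subset setCU subsetI -!disjoints_subset AB AU.
Qed.

Lemma lcp_near_good parts F k : near_good F k -> chordal F ->
  pairwise (fun A B => [disjoint A & B]) parts ->
  [disjoint verts F & \bigcup_(D <- parts) D] -> lcp_ok G F parts ->
  exists F', [/\ chordal F', verts F' = verts F :|: \bigcup_(D <- parts) D &
                 near_good F' (k + size parts)].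
Proof.
elim: parts F k => [|C rest IH] F k ngF chF pw dF ok.
  by exists F; split; rewrite // ?big_nil ?setU0 ?addn0.
move: pw => /= /andP [dC pw]; move: dF; rewrite big_cons => dF.
case: ok => _ ncC chC ok; rewrite -/(lcp_next F C _) in ncC chC ok.
have dR : [disjoint verts F :|: C & \bigcup_(D <- rest) D].
  rewrite disjoints_subset subUset -!disjoints_subset (disjoint_bigcup dC) andbT.
  by apply: disjointWr dF; apply: subsetUr.
have [|F' [ch' v' ng']] := IH _ _ (near_good_step dR ncC ngF) chC pw _ ok.
  by rewrite verts_hatG.
by exists F'; split=> //; rewrite ?addnS // v' verts_hatG /= setUA.
Qed.
End Chain.

Lemma near_good_delv_clique G C : near_good G (fun _ L => clique G L) (delv G C) 0.
Proof.
split=> [x y xV yV|K /cliqueP [sK cK]].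
  by case/and4P=> _ _ xy E; rewrite /adj xV yV xy.
exists set0; rewrite cards0 setD0; split=> //; apply/cliqueP; split.
  by apply: subset_trans sK _; apply: subsetDl.
move=> x y xK yK xy; case/and4P: (cK x y xK yK xy) => /= xV yV _ E.
by rewrite /adj xy E; move: xV yV; rewrite !inE => /andP [_ ->] /andP [_ ->].
Qed.

Lemma clique_extend G : verts G = setT -> extendable G (fun _ L => clique G L).
Proof.
move=> vG V V' L _ _ /cliqueP [_ cL] adjL; apply/cliqueP.
rewrite vG; split=> [|x y xL yL xy]; first exact: subsetT.
case yV: (y \in V); last by rewrite adjL // yV.
case xV: (x \in V); last by rewrite adjC adjL // 1?eq_sym // xV.
by apply: cL; rewrite // inE ?xL ?yL.
Qed.

(** The first part costs nothing here: [clique_hole_nbhd_minor] keeps the vertex [u] of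
    [clique_hatG], and the graph before chordalization has only edges of [G], so its minors are
    minors of [G]. *)
Lemma near_good_first_minor G C C1 R : [disjoint verts (delv G C) :|: C1 & R] ->
  NC_set (lcp_next G (delv G C) C1 R) C1 ->
  near_good G (rooted_minor G) (hatG (lcp_next G (delv G C) C1 R) C1) 0.
Proof.
move=> dR ncC; split=> [x y|K cK]; rewrite verts_hatG.
  by move=> xV yV xy; apply: adj_sub_hatG; apply: adj_sub_lcp_next.
exists set0; rewrite cards0 setD0; split=> //.
have [->|Kn0] := eqVneq K set0; first exact: rooted_minor0.
have [u [uK cKu nbK]] := clique_hatG ncC cK Kn0.
apply: (@rooted_minor_mono (lcp_next G (delv G C) C1 R)).
  move=> x y /adj_lcp_next [] // /and4P [xV yV xy E].
  by rewrite /adj xy E; move: xV yV; rewrite !inE => /andP [_ ->] /andP [_ ->].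
apply: clique_hole_nbhd_minor cKu nbK => //.
by case/cliqueP: cK => /subsetP /(_ u uK); rewrite verts_hatG.
Qed.

(** Isolates the first part, the only one that the two bounds treat differently; the last clause
    packages the induction over the others for any [good]. *)
Lemma has_lcp_first G l : verts G = setT -> has_lcp G l -> exists C C1 rest,
  let R := \bigcup_(D <- rest) D in
  let G1 := lcp_next G (delv G C) C1 R in
  [/\ l = (size rest).+1, [disjoint verts (delv G C) :|: C1 & R], NC_set G1 C1 &
      forall good k, extendable G good -> near_good G good (hatG G1 C1) k ->
      exists F, [/\ chordal F, verts F = setT & near_good G good F (k + size rest)]].
Proof.
move=> vG [C [[|C1 rest] [[C0 _ _] [_ pw eC] <- ok]]].
  by rewrite -eC big_nil eqxx in C0.
move: ok pw eC => /= [_ ncC chC ok] /andP [dC pw]; rewrite big_cons => eC.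
exists C, C1, rest; rewrite /=.
have dR : [disjoint verts (delv G C) :|: C1 & \bigcup_(D <- rest) D].
  rewrite disjoints_subset subUset -!disjoints_subset (disjoint_bigcup dC) andbT.
  by rewrite disjoint_sym disjoints_subset /= vG setTD setCK -eC subsetUr.
split=> // good k ext ng.
have [|F [chF vF ngF]] := lcp_near_good ext ng chC pw _ ok; first by rewrite verts_hatG.
exists F; split=> //; rewrite vF verts_hatG /= -setUA eC vG setTD setUC.
exact: setUCr.
Qed.

(** * Colouring chordal graphs *)

(* Dirac's lemma, strengthened for the induction: the simplicial vertex can be
   found outside any given clique N other than S. *)
Lemma chordal_simplicial G S N t : chordal G -> N \subset S ->
  {in N &, forall x y, x != y -> adj G x y} -> t \in S -> t \notin N ->
  exists s, [/\ s \in S, s \notin N &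
    {in S &, forall x y, adj G s x -> adj G s y -> x != y -> adj G x y}].
Proof.
move=> chG; move: {2}#|S| (leqnn #|S|) => n.
elim: n S N t => [|n IH] S N t szS sN cN tS tN.
  by move: szS; rewrite leqn0 cards_eq0 => /eqP S0; rewrite S0 inE in tS.
(* [v] is taken in [N] if possible and is [t] otherwise; either way the rest of [N] is adjacent to
   it. *)
have [v [vS Nv vN]] : exists v, [/\ v \in S, forall x, x \in N -> x != v -> adj G v x &
    v \notin N -> N = set0].
  case: (set_0Vmem N) => [N0|[v vN]]; first by exists t; split=> // x; rewrite N0 inE.
  exists v; split; first exact: (subsetP sN); last by rewrite vN.
  by move=> x xN xv; apply: cN; rewrite // eq_sym.
have szv : #|S :\ v| <= n by rewrite -ltnS (leq_trans _ szS) // [X in _ < X](cardsD1 v) vS.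
case: (boolP [exists z in S, (z != v) && ~~ adj G v z]).
  case/exists_inP=> z zS /andP [zv nvz].
  pose S' := [set y in S | (y != v) && ~~ adj G v y].
  have zS' : z \in S' by rewrite inE zS zv.
  pose Z := component G S' z.
  have sZ : Z \subset S' := component_sub G zS'.
  have ZS' y : y \in Z -> [/\ y \in S, y != v & ~~ adj G v y].
    by move/(subsetP sZ); rewrite inE => /and3P [].
  (* The boundary in [S] of a component [Z] of the non-neighbours of [v]. Its vertices are
     neighbours of [v] and form a clique, since two nonadjacent ones joined through [Z] would give a
     hole with apex [v]. *)
  pose Nb := [set y in S | (y \notin Z) && [exists w in Z, adj G w y]].
  have Nbv y : y \in Nb -> [/\ y \in S, y \notin Z, adj G v y & exists2 w, w \in Z & adj G w y].
    rewrite inE => /and3P [yS yZ /exists_inP [w wZ wy]].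
    split=> //; last by exists w.
    apply: contraNT yZ => nvy; apply: (component_closed zS' wZ _ wy).
    rewrite inE yS nvy andbT.
    by apply: contraTneq wy => ->; rewrite adjC; case: (ZS' _ wZ).
  have cNb : {in Nb &, forall x y, x != y -> adj G x y}.
    move=> x y /Nbv [xS xZ vx [a aZ ax]] /Nbv [yS yZ vy [b bZ b_y]] xy.
    case: (boolP (adj G x y)) => // nxy.
    pose S1 := Z :|: [set x] :|: [set y].
    have cS1 : connected G S1.
      have cZx : connected G (Z :|: [set x]).
        apply: connectedU (component_connected zS') (@connected1 G x) aZ (set11 x) _.
        by rewrite ax orbT.
      apply: connectedU cZx (@connected1 G y) (_ : b \in _) (set11 y) _.
        by rewrite in_setU bZ.
      by rewrite b_y orbT.
    have xS1 : x \in S1 by rewrite !inE eqxx !orbT.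
    have yS1 : y \in S1 by rewrite !inE eqxx !orbT.
    have [||H [hH _ _ _]] := apex_hole _ xS1 yS1 vx vy xy nxy _ (cS1 _ _ xS1 yS1).
    - rewrite !in_setU !in_set1 !negb_or (adj_neq vx) (adj_neq vy) !andbT.
      by apply/negP => /ZS' []; rewrite eqxx.
    - move=> w; rewrite !in_setU !in_set1 => /orP [/orP [/ZS' [_ _ nvw]|/eqP ->]|/eqP ->]; auto.
      by rewrite (negbTE nvw).
    by have := chG H; rewrite hH.
  have zZ : z \in Z := component_root _ _ _.
  (* Induction applies to [Z] with its boundary, which misses [v]. The vertex found lies in [Z], so
     all its neighbours in [S] are present; being nonadjacent to [v] and distinct from it, it is
     outside [N]. *)
  have [||||s [sS1 sNb simp]] := IH (Z :|: Nb) Nb z _ _ cNb.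
  - apply: leq_trans szv; apply: subset_leq_card; apply/subsetP => y.
    rewrite in_setU in_setD1 => /orP [/ZS' [-> ->] //|/Nbv [-> _ vy _]].
    by rewrite eq_sym (adj_neq vy).
  - exact: subsetUr.
  - by rewrite inE zZ.
  - by apply/negP => /Nbv [_]; rewrite zZ.
  have sZ' : s \in Z by move: sS1; rewrite in_setU (negbTE sNb) orbF.
  have [sS sv nvs] := ZS' _ sZ'.
  have nbS x : x \in S -> adj G s x -> x \in Z :|: Nb.
    move=> xS sx; rewrite in_setU; case: (boolP (x \in Z)) => //= xZ.
    by rewrite inE xS xZ; apply/exists_inP; exists s.
  exists s; split=> //; first by apply: contraNN nvs => /Nv; apply.
  by move=> x y xS yS sx sy; apply: simp => //; apply: nbS.
rewrite negb_exists_in => /forall_inP univ.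
have {}univ z : z \in S -> z != v -> adj G v z.
  by move=> zS zv; move: (univ z zS); rewrite zv negbK.
(* Now [v] is adjacent to the rest of [S], so simplicial vertices of [S :\ v] stay simplicial in
   [S]. Induction needs a vertex other than [v] outside [N]; there is none only if [S] is [v]
   alone. *)
have [[t' [t'S t'v t'N]]|single] : (exists t', [/\ t' \in S, t' != v & t' \notin N]) \/
    (v \notin N /\ forall y, y \in S -> y = v).
  have [tv|tv] := eqVneq t v; last by left; exists t.
  rewrite tv in tN; case: (set_0Vmem (S :\ v)) => [S0|[y]].
    right; split=> // y yS; apply/eqP; apply: contraT => yv.
    by have := in_set0 y; rewrite -S0 in_setD1 yS yv.
  by case/setD1P=> yv yS; left; exists y; rewrite (vN tN) inE.
- have [|||||s [/setD1P [sv sS] sN' simp]] := IH (S :\ v) (N :\ v) t'.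
  + exact: szv.
  + exact: setSD.
  + by move=> x y /setD1P [_ xN] /setD1P [_ yN]; apply: cN.
  + by rewrite in_setD1 t'S t'v.
  + by rewrite in_setD1 (negbTE t'N) andbF.
  exists s; split=> //; first by move: sN'; rewrite in_setD1 sv.
  move=> x y xS yS sx sy xy.
  have [xv|xv] := eqVneq x v; first by rewrite xv univ // eq_sym -xv.
  have [yv|yv] := eqVneq y v; first by rewrite yv adjC univ.
  by apply: simp; rewrite // in_setD1 ?xv ?yv.
- case: single => vN' all_v; exists v; split=> // x y /all_v -> _.
  by rewrite adjxx.
Qed.

(** Greedy colouring: a simplicial vertex [s] is coloured last. It forms a clique of [F] with its
    neighbours, so there are fewer than [m] of them, each blocking at most one colour. *)
Lemma chordal_DP_colorable (e : rel T) F m : chordal F ->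
  (forall x y, adj (graph_of e) x y -> adj F x y) -> verts F = setT ->
  (forall K, clique F K -> #|K| <= m) -> DP_colorable e m.
Proof.
move=> chF sF vF clF M [Madj Msym Mf Mi].
(* An arbitrary colouring to start from; if [m = 0], then [T] is empty, as a single vertex is a
   clique. *)
have f0 : exists f : T -> 'I_m, True.
  case: m clF {M Madj Msym Mf Mi} => [clF|m _]; last by exists (fun _ => ord0).
  have noT (x : T) : False.
    suff /clF : clique F [set x] by rewrite cards1.
    apply/cliqueP; rewrite vF; split=> [|y z]; first exact: subsetT.
    by rewrite !inE => /eqP -> /eqP ->; rewrite eqxx.
  by exists (fun x => match noT x with end).
suff: forall n (S : {set T}), #|S| <= n ->
  exists f : T -> 'I_m, forall u v, u \in S -> v \in S -> ~~ M u v (f u) (f v).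
  by move=> /(_ #|T| setT (max_card _)) [f Hf]; exists f => u v; apply: Hf.
elim=> [|n IH] S szS.
  move: szS; rewrite leqn0 cards_eq0 => /eqP ->.
  by case: f0 => f _; exists f => u v; rewrite inE.
case: (set_0Vmem S) => [->|[t tS]].
  by case: f0 => f _; exists f => u v; rewrite inE.
have [||s [sS _ simp]] := @chordal_simplicial F S set0 t chF (sub0set _) _ tS _.
- by move=> x y; rewrite inE.
- by rewrite inE.
have [|f Hf] := IH (S :\ s).
  by rewrite -ltnS (leq_trans _ szS) // [X in _ < X](cardsD1 s) sS.
pose Ns := [set y in S | adj F s y].
have cNs : #|Ns| < m.
  have sNs : s \notin Ns by rewrite inE adjxx andbF.
  have := clF (s |: Ns); rewrite cardsU1 sNs add1n; apply; apply/cliqueP; split.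
    by rewrite vF subsetT.
  move=> x y /setU1P [->|xN] /setU1P [->|yN]; rewrite ?eqxx //.
  - by move: yN; rewrite inE => /andP [].
  - by move: xN; rewrite inE adjC => /andP [].
  - by move: xN yN; rewrite !inE => /andP [xS sx] /andP [yS sy]; apply: simp.
(* The colour at [s] blocked by [u]; the default [f s] can only add to the colours avoided. *)
pose g u := odflt (f s) [pick j | M s u j (f u)].
have [c cP] : exists c, c \notin g @: Ns.
  apply/existsP; rewrite -negb_forall; apply: contraTN cNs => /forallP allF.
  rewrite -leqNgt -[X in X <= _](card_ord m); apply: leq_trans (leq_imset_card g Ns).
  by apply: subset_leq_card; apply/subsetP => j _; apply: allF.
have Mc w : w \in S -> ~~ M s w c (f w).
  move=> wS; apply: contraNN cP => Mw; apply/imsetP; exists w.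
    by rewrite inE wS sF //; apply: Madj Mw.
  rewrite /g; case: pickP => [j Mj|/(_ c)]; last by rewrite Mw.
  exact: Mi Mw Mj.
have Mss i j : ~~ M s s i j by apply/negP => /Madj; rewrite adjxx.
exists (fun y => if y == s then c else f y) => u v uS vS.
case: (eqVneq u s) => [->|us]; case: (eqVneq v s) => [->|vs] //.
- exact: Mc.
- by rewrite Msym; apply: Mc.
- by apply: Hf; rewrite !inE ?us ?vs.
Qed.

(** * The two bounds *)

Lemma chi_DP_le (e : rel T) m : DP_colorable e m -> chi_DP e <= m.
Proof.
move=> dpm; rewrite /chi_DP; case: ex_minnP => k _; apply.
by rewrite /DP_colorableb; case: excluded_middle_informative.
Qed.

Lemma leq_card_setD K D k m : #|D| <= k -> #|K :\: D| <= m -> #|K| <= m + k.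
Proof.
move=> cD cKD; rewrite -(cardsID D K) addnC leq_add //.
by apply: leq_trans cD; apply: subset_leq_card; apply: subsetIr.
Qed.

End Graphs.

Theorem theorem4p1 (T : finType) (e : rel T)
    (e_sym : symmetric e) (e_irr : irreflexive e) :
  (forall l : nat, nc_index (graph_of e) l ->
     chi_DP e <= clique_num (graph_of e) + l) /\
  (forall n l : nat, ~ chordal (graph_of e) -> ~ has_Kminor (graph_of e) n ->
     nc_index (graph_of e) l -> chi_DP e <= n - 2 + l).
Proof.
set G := graph_of e; have vG : verts G = setT by [].
have cliqueG K : clique G K -> #|K| <= clique_num G.
  by move=> cK; apply: (@leq_bigmax_cond _ _ (fun K : {set T} => #|K|)).
have colour F m k good : chordal F -> verts F = setT -> near_good G good F k ->
    (forall L, good setT L -> #|L| <= m) -> chi_DP e <= m + k.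
  move=> chF vF [F1 F2] goodm; apply/chi_DP_le/(chordal_DP_colorable chF) => //.
    by move=> x y; apply: F1; rewrite vF inE.
  by move=> K /F2 [D [cD]]; rewrite vF => /goodm; apply: leq_card_setD.
split=> [l [[chG ->]|[_ [/(has_lcp_first vG) [C [C1 [rest [-> dR ncC lcp]]]] _]]]|].
- by rewrite addn0; apply/chi_DP_le/(chordal_DP_colorable chG).
- have ext : extendable G (fun _ L => clique G L) by apply: clique_extend.
  (* Deleting [C] leaves a graph with [k = 0], so with the first part included the total cost is
     [1 + size rest], which is [l]. *)
  have [F [chF vF ngF]] := lcp _ _ ext (near_good_step ext dR ncC (near_good_delv_clique G C)).
  exact: colour chF vF ngF _.
move=> n l nch nK [[/nch //]|[_ [/(has_lcp_first vG) [C [C1 [rest [-> dR ncC lcp]]]] _]]].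
have [F [chF vF ngF]] := lcp _ _ (@rooted_minor_extend T G) (near_good_first_minor dR ncC).
have minor_small L : rooted_minor G setT L -> #|L| <= n.-1.
  (* A minor of order 0 always exists, so [n = 0] contradicts [nK]. *)
  move=> mL; case: n nK => [|n] nK.
    by case: nK; apply: (rooted_minor_Kminor _ mL) => //; rewrite vG.
  rewrite /= leqNgt; apply/negP => nL; apply: nK.
  by apply: (rooted_minor_Kminor _ mL nL); rewrite vG.
apply: leq_trans (colour _ _ _ _ chF vF ngF minor_small) _.
rewrite add0n addnS -addSn leq_add2r.
(* The remaining inequality [n.-1 <= (n - 2).+1] holds for every [n] under truncated subtraction. *)
by case: (n) => [|[|k]] //; rewrite subn2.
Qed.
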